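(* Let $n\ge5$ and suppose a group $G$ splits as a free product $G=G_1\ast\dots\ast G_n$ where the factor groups $G_i$ are non-trivial, freely indecomposable, not infinite cyclic, and pairwise non-isomorphic. Write $[n]=\{1,\dots,n\}$. Then $\mathrm{Out}(G)$ is generated by the $n(n-1)$ groups $G_{i_j}\cong G_i$ ($i,j\in[n]$ distinct) and $\Phi=\prod_{i=1}^n\mathrm{Aut}(G_i)$, subject to the relations: 1. $[f_{i_j}(g),f_{i_k}(h)]=1$ for all $g,h\in G_i$, for all $i\in[n]$ and all distinct $j,k\in[n]-\{i\}$; 2. $[f_{i_j}(g),f_{k_l}(h)]=1$ for all $g\in G_i$, $h\in G_k$, for all distinct $i,j,k,l\in[n]$; 3. $[f_{j_k}(g),f_{i_j}(h)f_{i_k}(h)]=1$ for all $g\in G_j$, $h\in G_i$, for all distinct $i,j,k\in[n]$; 4. $f_{i_{v_1}}(g)\cdots f_{i_{v_{n-1}}}(g)=\mathrm{Ad}_{G_i}(g)$ for all $g\in G_i$, for all $i\in[n]$, where $\{v_1,\dots,v_{n-1}\}=[n]-\{i\}$; 5. $\varphi^{-1}f_{i_j}(g)\varphi=f_{i_j}(\varphi(g))$ for all $g\in G_i$, for all distinct $i,j\in[n]$ and all $\varphi\in\Phi$; together with all relations in the groups $G_{i_j}$ and in $\Phi$.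
   Context: Automorphisms act on the right, so a product $\psi\chi$ means first $\psi$, then $\chi$. For $i\neq j$, $f_{i_j}(g)$ ($g\in G_i$) is the class in $\mathrm{Out}(G)$ of the automorphism of $G$ which sends each $x\in G_j$ to $gxg^{-1}$ and fixes every $G_k$ with $k\ne j$ pointwise; $G_{i_j}=\{f_{i_j}(g):g\in G_i\}$, and $f_{i_j}:G_i\to G_{i_j}$ is an isomorphism. The group $\Phi=\prod_{i=1}^n\mathrm{Aut}(G_i)$ is identified with the group of (classes of) factor automorphisms, i.e. those $\varphi\in\mathrm{Aut}(G)$ restricting to an automorphism of each $G_i$. $\mathrm{Ad}_{G_i}(g)\in\Phi$ is the automorphism acting as $x\mapsto g^{-1}xg$ on $G_i$ and trivially on $G_k$, $k\neq i$. ''Generated by groups $K_1,\dots,K_r$ subject to relations $R$'' means: the natural homomorphism from the quotient of the free product $K_1\ast\dots\ast K_r$ by the normal closure of $R$ is an isomorphism onto the group in question. *)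

(* Defs.v *)
From HB Require Import structures.
From mathcomp Require Import all_boot.
From mathcomp Require Import boolp classical_sets functions cardinality.

Set Implicit Arguments.
Unset Strict Implicit.
Unset Printing Implicit Defensive.

Local Open Scope group_scope.
Local Open Scope quotient_scope.

Notation "{ 'hom' G -> H }" := (UMagmaMorphism.type G%type H%type)
  (at level 0, G at level 98, H at level 99, format "{ 'hom'  G  ->  H }")
  : type_scope.

Record normal_subgroup (G : groupType) := NormalSubgroup {
  nmem :> G -> Prop;
  nmem1 : nmem 1;
  nmemM : forall x y, nmem x -> nmem y -> nmem (x * y);
  nmemV : forall x, nmem x -> nmem x^-1;
  nmemJ : forall x y, nmem x -> nmem (x ^ y) }.

Section Quotient.
Variables (G : groupType) (N : normal_subgroup G).

Definition quot_rel (x y : G) : bool := `[< N (x^-1 * y) >].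

Fact quot_rel_refl : reflexive quot_rel.
Proof. by move=> x; apply/asboolP; rewrite mulVg; exact: nmem1. Qed.

Fact quot_rel_sym : symmetric quot_rel.
Proof.
by move=> x y; apply/asboolP/asboolP=> /nmemV; rewrite invgM invgK.
Qed.

Fact quot_rel_trans : transitive quot_rel.
Proof.
move=> y x z /asboolP xy /asboolP yz; apply/asboolP.
by rewrite -(mulgK y x^-1) -mulgA; exact: nmemM.
Qed.

Canonical quot_equiv := EquivRel quot_rel quot_rel_refl quot_rel_sym
  quot_rel_trans.

Definition quotg := {eq_quot quot_equiv}.
HB.instance Definition _ := Choice.on quotg.

Definition qclass (x : G) : quotg := \pi_{eq_quot quot_equiv} x.

Lemma qclassP x y : qclass x = qclass y <-> N (x^-1 * y).
Proof.
by split=> [/eqmodP/asboolP //|Nxy]; apply/eqmodP/asboolP.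
Qed.

Definition qrepr (q : quotg) : G := repr (q : {eq_quot quot_equiv}).

Lemma qreprK : cancel qrepr qclass.
Proof. by move=> q; rewrite /qclass /qrepr reprK. Qed.

Definition quotg_one : quotg := qclass 1.
Definition quotg_mul (p q : quotg) : quotg := qclass (qrepr p * qrepr q).
Definition quotg_inv (q : quotg) : quotg := qclass (qrepr q)^-1.

Lemma qclass_mul x y : quotg_mul (qclass x) (qclass y) = qclass (x * y).
Proof.
rewrite /quotg_mul; apply/qclassP.
have /qclassP Nx := qreprK (qclass x); have /qclassP Ny := qreprK (qclass y).
set x' := qrepr _ in Nx *; set y' := qrepr _ in Ny *.
have -> : (x' * y')^-1 * (x * y) = (x'^-1 * x) ^ y' * (y'^-1 * y).
  by rewrite conjgE invgM -!mulgA mulVKg.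
by apply: nmemM => //; apply: nmemJ.
Qed.

Lemma qclass_inv x : quotg_inv (qclass x) = qclass x^-1.
Proof.
rewrite /quotg_inv; apply/qclassP.
have /qclassP/nmemV Nx := qreprK (qclass x).
set x' := qrepr _ in Nx *.
have -> : x'^-1^-1 * x^-1 = (x'^-1 * x)^-1 ^ x'^-1.
  by rewrite conjgE invgM !invgK !mulgA mulgK.
exact: nmemJ.
Qed.

Fact quotg_mulA : associative quotg_mul.
Proof.
move=> p q r; rewrite -(qreprK p) -(qreprK q) -(qreprK r).
by rewrite !qclass_mul mulgA.
Qed.
Fact quotg_mul1 : left_id quotg_one quotg_mul.
Proof. by move=> p; rewrite -(qreprK p) !qclass_mul mul1g. Qed.
Fact quotg_1mul : right_id quotg_one quotg_mul.
Proof. by move=> p; rewrite -(qreprK p) !qclass_mul mulg1. Qed.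
Fact quotg_mulV : left_inverse quotg_one quotg_inv quotg_mul.
Proof. by move=> p; rewrite -(qreprK p) qclass_inv qclass_mul mulVg. Qed.
Fact quotg_Vmul : right_inverse quotg_one quotg_inv quotg_mul.
Proof. by move=> p; rewrite -(qreprK p) qclass_inv qclass_mul mulgV. Qed.

HB.instance Definition _ := isGroup.Build quotg quotg_mulA quotg_mul1
  quotg_1mul quotg_mulV quotg_Vmul.

Fact qclass_morph : {morph qclass : x y / x * y}.
Proof. by move=> x y; rewrite -qclass_mul. Qed.
HB.instance Definition _ :=
  isUMagmaMorphism.Build G quotg qclass (erefl, qclass_morph).

Section Lift.
Variables (L : groupType) (f : {hom G -> L}).
Hypothesis fN : forall x, N x -> f x = 1.

Definition quotg_lift of (forall x, N x -> f x = 1) := fun q : quotg => f (qrepr q).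

Lemma quotg_liftE x : quotg_lift fN (qclass x) = f x.
Proof.
have /qclassP/fN := qreprK (qclass x).
by rewrite gmulfM gmulfV => /(canRL (mulVKg _)); rewrite mulg1 => ->.
Qed.

Fact quotg_lift_morph : monoid_morphism (quotg_lift fN).
Proof.
split=> [|p q]; first by rewrite (quotg_liftE 1) gmulf1.
by rewrite -(qreprK p) -(qreprK q) -qclass_morph !quotg_liftE gmulfM.
Qed.
HB.instance Definition _ :=
  isUMagmaMorphism.Build quotg L (quotg_lift fN) quotg_lift_morph.
End Lift.

End Quotient.

Section NormalClosure.
Variables (G : groupType) (R : set G).

Definition normal_closure_mem (x : G) : Prop :=
  forall N : normal_subgroup G, (forall r, R r -> N r) -> N x.

Fact ncl1 : normal_closure_mem 1.
Proof. by move=> N _; exact: nmem1. Qed.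
Fact nclM x y : normal_closure_mem x -> normal_closure_mem y ->
  normal_closure_mem (x * y).
Proof. by move=> Rx Ry N RN; apply: nmemM; [apply: Rx | apply: Ry]. Qed.
Fact nclV x : normal_closure_mem x -> normal_closure_mem x^-1.
Proof. by move=> Rx N RN; apply: nmemV; apply: Rx. Qed.
Fact nclJ x y : normal_closure_mem x -> normal_closure_mem (x ^ y).
Proof. by move=> Rx N RN; apply: nmemJ; apply: Rx. Qed.

Definition normal_closure := NormalSubgroup ncl1 nclM nclV nclJ.

End NormalClosure.

Section FreeProduct.
Variables (I : choiceType) (K : I -> groupType).

Definition fp_word := seq {i : I & K i}.
HB.instance Definition _ := Choice.on fp_word.

Inductive fp_eq : fp_word -> fp_word -> Prop :=
| fp_refl w : fp_eq w w
| fp_sym w w' : fp_eq w w' -> fp_eq w' w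
| fp_trans w w' w'' : fp_eq w w' -> fp_eq w' w'' -> fp_eq w w''
| fp_one u v i : fp_eq (u ++ Tagged K (1 : K i) :: v) (u ++ v)
| fp_mul u v i (x y : K i) :
    fp_eq (u ++ Tagged K x :: Tagged K y :: v) (u ++ Tagged K (x * y) :: v).

Definition fp_eqb (w w' : fp_word) : bool := `[< fp_eq w w' >].

Fact fp_eqb_refl : reflexive fp_eqb.
Proof. by move=> w; apply/asboolP; exact: fp_refl. Qed.
Fact fp_eqb_sym : symmetric fp_eqb.
Proof. by move=> w w'; apply/asboolP/asboolP; exact: fp_sym. Qed.
Fact fp_eqb_trans : transitive fp_eqb.
Proof.
by move=> w' w w'' /asboolP H /asboolP H'; apply/asboolP; exact: fp_trans H'.
Qed.

Canonical fp_equiv := EquivRel fp_eqb fp_eqb_refl fp_eqb_sym fp_eqb_trans.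

Definition free_prod := {eq_quot fp_equiv}.
HB.instance Definition _ := Choice.on free_prod.

Definition fp_class (w : fp_word) : free_prod := \pi_{eq_quot fp_equiv} w.

Lemma fp_classP w w' : fp_class w = fp_class w' <-> fp_eq w w'.
Proof. by split=> [/eqmodP/asboolP //|ww']; apply/eqmodP/asboolP. Qed.

Definition fp_repr (a : free_prod) : fp_word := repr (a : {eq_quot fp_equiv}).

Lemma fp_reprK : cancel fp_repr fp_class.
Proof. by move=> a; rewrite /fp_class /fp_repr reprK. Qed.

Lemma fp_eq_cat w1 w1' w2 w2' :
  fp_eq w1 w1' -> fp_eq w2 w2' -> fp_eq (w1 ++ w2) (w1' ++ w2').
Proof.
have catl u v v' : fp_eq v v' -> fp_eq (u ++ v) (u ++ v').
  elim=> {v v'} [w|w w' _|w w' w'' _ IH _|a b i|a b i x y].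
  - exact: fp_refl.
  - exact: fp_sym.
  - exact: fp_trans.
  - by rewrite !catA; exact: fp_one.
  - by rewrite !catA; exact: fp_mul.
have catr u v v' : fp_eq v v' -> fp_eq (v ++ u) (v' ++ u).
  elim=> {v v'} [w|w w' _|w w' w'' _ IH _|a b i|a b i x y].
  - exact: fp_refl.
  - exact: fp_sym.
  - exact: fp_trans.
  - by rewrite -!catA; exact: fp_one.
  - by rewrite -!catA; exact: fp_mul.
by move=> H1 H2; apply: fp_trans (catr _ _ _ H1) (catl _ _ _ H2).
Qed.

Definition fp_word_inv (w : fp_word) : fp_word :=
  rev [seq Tagged K (tagged t : K (tag t))^-1 | t : {i : I & K i} <- w].

Lemma fp_word_invP w : fp_eq (fp_word_inv w ++ w) [::].
Proof.
elim: w => [|[i x] w IH]; first exact: fp_refl.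
rewrite /fp_word_inv map_cons rev_cons cat_rcons; apply: fp_trans IH.
apply: fp_trans (fp_mul _ _ _ _) _ => /=; rewrite mulVg; exact: fp_one.
Qed.

Lemma fp_word_invK : involutive fp_word_inv.
Proof.
move=> w; rewrite /fp_word_inv map_rev revK -map_comp -[RHS]map_id.
by apply: eq_map => -[i x] /=; rewrite invgK.
Qed.

Definition fp_op1 : free_prod := fp_class [::].
Definition fp_opM (a b : free_prod) : free_prod :=
  fp_class (fp_repr a ++ fp_repr b).
Definition fp_opV (a : free_prod) : free_prod := fp_class (fp_word_inv (fp_repr a)).

Lemma fp_class_cat w w' : fp_opM (fp_class w) (fp_class w') = fp_class (w ++ w').
Proof. by apply/fp_classP; apply: fp_eq_cat; apply/fp_classP/fp_reprK. Qed.

Fact fp_opA : associative fp_opM.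
Proof.
move=> a b c; rewrite -(fp_reprK a) -(fp_reprK b) -(fp_reprK c).
by rewrite !fp_class_cat catA.
Qed.
Fact fp_op1M : left_id fp_op1 fp_opM.
Proof. by move=> a; rewrite -(fp_reprK a) fp_class_cat. Qed.
Fact fp_opM1 : right_id fp_op1 fp_opM.
Proof. by move=> a; rewrite -(fp_reprK a) fp_class_cat cats0. Qed.
Fact fp_opVM : left_inverse fp_op1 fp_opV fp_opM.
Proof.
move=> a; rewrite -{2}(fp_reprK a) fp_class_cat; apply/fp_classP.
exact: fp_word_invP.
Qed.
Fact fp_opMV : right_inverse fp_op1 fp_opV fp_opM.
Proof.
move=> a; rewrite -{1}(fp_reprK a) fp_class_cat; apply/fp_classP.
by rewrite -{1}(fp_word_invK (fp_repr a)); exact: fp_word_invP.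
Qed.

HB.instance Definition _ := isGroup.Build free_prod fp_opA fp_op1M fp_opM1
  fp_opVM fp_opMV.

Definition fp_in (i : I) (x : K i) : free_prod := fp_class [:: Tagged K x].

Fact fp_in_morph i : monoid_morphism (@fp_in i).
Proof.
split=> [|x y]; first by apply/fp_classP; exact: (fp_one [::] [::]).
rewrite /fp_in [RHS]fp_class_cat; apply/fp_classP; apply: fp_sym.
exact: (fp_mul [::] [::]).
Qed.
HB.instance Definition _ i :=
  isUMagmaMorphism.Build (K i) free_prod (@fp_in i) (fp_in_morph i).

Section Lift.
Variables (L : groupType) (h : forall i, {hom K i -> L}).

Definition fp_eval (w : fp_word) : L := \prod_(t <- w) h (tag t) (tagged t).

Lemma fp_eval_eq w w' : fp_eq w w' -> fp_eval w = fp_eval w'.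
Proof.
rewrite /fp_eval; elim=> {w w'} [w|w w' _ ->|w w' w'' _ -> _ ->|u v i|u v i x y].
- by [].
- by [].
- by [].
- by rewrite !big_cat big_cons /= gmulf1 mul1g.
- by rewrite !big_cat !big_cons /= gmulfM !mulgA.
Qed.

Definition fp_lift (a : free_prod) : L := fp_eval (fp_repr a).

Lemma fp_liftE w : fp_lift (fp_class w) = fp_eval w.
Proof. by apply: fp_eval_eq; apply/fp_classP/fp_reprK. Qed.

Lemma fp_lift_in i x : fp_lift (@fp_in i x) = h i x.
Proof. by rewrite fp_liftE /fp_eval big_seq1. Qed.

Fact fp_lift_morph : monoid_morphism fp_lift.
Proof.
split=> [|a b]; first by rewrite fp_liftE /fp_eval big_nil.
rewrite -(fp_reprK a) -(fp_reprK b) -[_ * _]/(fp_opM _ _) fp_class_cat.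
by rewrite !fp_liftE /fp_eval big_cat.
Qed.
HB.instance Definition _ :=
  isUMagmaMorphism.Build free_prod L fp_lift fp_lift_morph.
End Lift.

Lemma fp_hom_eq (L : groupType) (f g : {hom free_prod -> L}) :
  (forall i x, f (@fp_in i x) = g (@fp_in i x)) -> f =1 g.
Proof.
move=> fg a; rewrite -(fp_reprK a); elim: (fp_repr a) => [|[i x] w IH].
  by rewrite -[fp_class _]/(1 : free_prod) !gmulf1.
have -> : fp_class (existT _ i x :: w) = @fp_in i x * fp_class w.
  by rewrite -[RHS]/(fp_opM _ _) fp_class_cat.
by rewrite !gmulfM fg IH.
Qed.

End FreeProduct.

Section IsFreeProduct.
Variables (I : choiceType) (K : I -> groupType) (G : groupType).
Variable iota : forall i, {hom K i -> G}.

Definition is_free_product : Prop := bijective (fp_lift iota).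

Hypothesis splitG : is_free_product.

Fact fp_coord_subproof (x : G) : exists a, fp_lift iota a = x.
Proof. by case: splitG => g _ gK; exists (g x). Qed.

Definition fp_coord (x : G) : free_prod K := sval (cid (fp_coord_subproof x)).

Lemma fp_coordK : cancel fp_coord (fp_lift iota).
Proof. by move=> x; rewrite /fp_coord; case: cid. Qed.

Lemma fp_liftK : cancel (fp_lift iota) fp_coord.
Proof. by move=> a; apply: (bij_inj splitG); rewrite fp_coordK. Qed.

Section Ext.
Variables (L : groupType) (h : forall i, {hom K i -> L}).

Definition fp_ext (x : G) : L := fp_lift h (fp_coord x).

Lemma fp_extE i (x : K i) : fp_ext (iota i x) = h i x.
Proof. by rewrite /fp_ext -(fp_lift_in iota) fp_liftK fp_lift_in. Qed.

Fact fp_ext_morph : monoid_morphism fp_ext.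
Proof.
split=> [|x y]; rewrite /fp_ext.
  by rewrite -(@gmulf1 _ _ (fp_lift iota)) fp_liftK gmulf1.
rewrite -{1}(fp_coordK x) -{1}(fp_coordK y) -gmulfM fp_liftK.
by rewrite gmulfM.
Qed.
HB.instance Definition _ := isUMagmaMorphism.Build G L fp_ext fp_ext_morph.
End Ext.

Lemma hom_eq_on_factors (L : groupType) (f g : {hom G -> L}) :
  (forall i x, f (iota i x) = g (iota i x)) -> f =1 g.
Proof.
move=> fg x; rewrite -(fp_coordK x).
apply: (@fp_hom_eq _ _ _ (f \o fp_lift iota) (g \o fp_lift iota)) => i y /=.
by rewrite fp_lift_in.
Qed.

Lemma is_free_product_inj i : injective (iota i).
Proof.
pose h k : {hom K k -> K i} :=
  if k =P i is ReflectT e then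
    ecast j {hom K k -> K j} e (@idfun (K k) : {hom K k -> K k})
  else (@one_fun (K k) (K i) : {hom K k -> K i}).
apply: (@can_inj _ _ _ (fp_ext h)) => x; rewrite fp_extE /h.
by case: eqP => // e; rewrite eq_axiomK.
Qed.

End IsFreeProduct.
Arguments is_free_product {I K G} iota.

(* Relations are given as relators: elements of the free product of the K i that
   are to become trivial. *)
Definition presented_by (I : choiceType) (K : I -> groupType) (Q : groupType)
    (kappa : forall i, {hom K i -> Q}) (R : set (free_prod K)) : Prop :=
  exists relQ : forall x, normal_closure R x -> fp_lift kappa x = 1,
    bijective (quotg_lift relQ).

Definition trivial_group (G : groupType) : Prop := forall x : G, x = 1.

Definition infinite_cyclic (G : groupType) : Prop :=
  infinite_set [set: G] /\
  exists g : G, forall x, exists m : nat, x = g ^+ m \/ x = g ^- m.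

Definition freely_indecomposable (G : groupType) : Prop :=
  forall (K : bool -> groupType) (iota : forall b, {hom K b -> G}),
    is_free_product iota -> exists b, trivial_group (K b).

Definition isomorphic (G H : groupType) : Prop :=
  exists f : {hom G -> H}, bijective f.

Section Image.
Variables (G H : groupType) (f : {hom G -> H}).

Definition in_image : pred H := fun y => `[< exists x, f x = y >].

Record hom_image := HomImage { image_val :> H; _ : in_image image_val }.
HB.instance Definition _ := [isSub for image_val].
HB.instance Definition _ := [Choice of hom_image by <:].

Fact in_image_closed : group_closed in_image.
Proof.
split=> [|_ _ /asboolP[x <-] /asboolP[y <-]]; apply/asboolP.
  by exists 1; exact: gmulf1.
by exists (x / y); rewrite gmulfF.
Qed.
HB.instance Definition _ :=
  SubChoice_isSubGroup.Build H in_image hom_image in_image_closed.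

Fact image_val_morph : monoid_morphism image_val.
Proof. by split=> [|x y]; [exact: val1 | exact: valM]. Qed.
HB.instance Definition _ :=
  isUMagmaMorphism.Build hom_image H image_val image_val_morph.

Fact to_image_subproof x : in_image (f x).
Proof. by apply/asboolP; exists x. Qed.

Definition to_image (x : G) : hom_image := HomImage (to_image_subproof x).

Fact to_image_morph : monoid_morphism to_image.
Proof. by split=> [|x y]; apply/val_inj; rewrite /= ?gmulf1 ?gmulfM. Qed.
HB.instance Definition _ :=
  isUMagmaMorphism.Build G hom_image to_image to_image_morph.
End Image.

Section Aut.
Variable G : groupType.

Definition is_aut : pred (G -> G) :=
  fun f => `[< {morph f : x y / x * y} /\ bijective f >].

Record Aut := MkAut { aut_fun :> G -> G; _ : is_aut aut_fun }.
HB.instance Definition _ := [isSub for aut_fun].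
HB.instance Definition _ := [Choice of Aut by <:].

Lemma aut_morph (a : Aut) : {morph a : x y / x * y}.
Proof. by case: a => f /= /asboolP[]. Qed.

Lemma aut_bij (a : Aut) : bijective a.
Proof. by case: a => f /= /asboolP[]. Qed.

Fact aut_monoid_morph (a : Aut) : monoid_morphism a.
Proof.
split; last exact: aut_morph.
by apply: (@mulgI _ (a 1)); rewrite -aut_morph !mulg1.
Qed.
HB.instance Definition _ (a : Aut) :=
  isUMagmaMorphism.Build G G a (aut_monoid_morph a).

Lemma autP (a b : Aut) : a =1 b -> a = b.
Proof. by move=> ab; apply/val_inj/funext. Qed.

Fact aut_one_subproof : is_aut id.
Proof. by apply/asboolP; split=> //; exists id. Qed.
Definition aut_one := MkAut aut_one_subproof.

(* Automorphisms act on the right: a * b is first a, then b. *)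
Fact aut_mul_subproof (a b : Aut) : is_aut (b \o a).
Proof.
apply/asboolP; split=> [x y /=|]; first by rewrite !aut_morph.
exact: bij_comp (aut_bij b) (aut_bij a).
Qed.
Definition aut_mul a b := MkAut (aut_mul_subproof a b).

Fact aut_inv_ex (a : Aut) : exists f, cancel a f /\ cancel f a.
Proof. by case: (aut_bij a) => f aK fK; exists f. Qed.
Definition aut_inv_fun (a : Aut) : G -> G := sval (cid (aut_inv_ex a)).

Lemma aut_funK (a : Aut) : cancel a (aut_inv_fun a).
Proof. by rewrite /aut_inv_fun; case: cid => f []. Qed.
Lemma aut_inv_funK (a : Aut) : cancel (aut_inv_fun a) a.
Proof. by rewrite /aut_inv_fun; case: cid => f []. Qed.

Fact aut_inv_subproof (a : Aut) : is_aut (aut_inv_fun a).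
Proof.
apply/asboolP; split=> [x y|].
  by apply: (can_inj (aut_funK a)); rewrite aut_morph !aut_inv_funK.
by exists a; [exact: aut_inv_funK | exact: aut_funK].
Qed.
Definition aut_inv a := MkAut (aut_inv_subproof a).

Fact aut_mulA : associative aut_mul.
Proof. by move=> a b c; apply: autP. Qed.
Fact aut_mul1 : left_id aut_one aut_mul.
Proof. by move=> a; apply: autP. Qed.
Fact aut_1mul : right_id aut_one aut_mul.
Proof. by move=> a; apply: autP. Qed.
Fact aut_mulV : left_inverse aut_one aut_inv aut_mul.
Proof. by move=> a; apply: autP => x /=; exact: aut_inv_funK. Qed.
Fact aut_Vmul : right_inverse aut_one aut_inv aut_mul.
Proof. by move=> a; apply: autP => x /=; exact: aut_funK. Qed.

HB.instance Definition _ :=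
  isGroup.Build Aut aut_mulA aut_mul1 aut_1mul aut_mulV aut_Vmul.

Fact inn_subproof (g : G) : is_aut (fun x => x ^ g).
Proof.
apply/asboolP; split=> [x y|]; first exact: conjMg.
by exists (fun x => x ^ g^-1) => x; rewrite ?conjgK ?conjgKV.
Qed.
Definition inn (g : G) : Aut := MkAut (inn_subproof g).

Lemma innE g x : inn g x = g^-1 * x * g.
Proof. by rewrite /= conjgE mulgA. Qed.

Fact inn_morph : monoid_morphism inn.
Proof.
by split=> [|g h]; apply: autP => x /=; [exact: conjg1 | exact: conjgM].
Qed.
HB.instance Definition _ := isUMagmaMorphism.Build G Aut inn inn_morph.

Definition Inn_mem (a : Aut) : Prop := exists g, a = inn g.

Fact Inn1 : Inn_mem 1.
Proof. by exists 1; rewrite gmulf1. Qed.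
Fact InnM a b : Inn_mem a -> Inn_mem b -> Inn_mem (a * b).
Proof. by move=> [g ->] [h ->]; exists (g * h); rewrite gmulfM. Qed.
Fact InnV a : Inn_mem a -> Inn_mem a^-1.
Proof. by move=> [g ->]; exists g^-1; rewrite gmulfV. Qed.
Fact InnJ a b : Inn_mem a -> Inn_mem (a ^ b).
Proof.
move=> [g ->]; exists (b g); apply: autP => x /=.
by rewrite -[LHS]/(b (aut_inv_fun b x ^ g)) gmulfJ /= aut_inv_funK.
Qed.

Definition Inn : normal_subgroup Aut := NormalSubgroup Inn1 InnM InnV InnJ.

Definition Out := quotg Inn.
HB.instance Definition _ := Group.on Out.

Definition out_class : {hom Aut -> Out} := @qclass _ Inn.

End Aut.

Section ConjLeft.
Variables (G : groupType) (g : G).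
Definition conj_left (x : G) : G := g * x * g^-1.
Fact conj_left_morph : monoid_morphism conj_left.
Proof.
by split=> [|x y]; rewrite /conj_left ?mulg1 ?mulgV // !mulgA mulgVK.
Qed.
HB.instance Definition _ := isUMagmaMorphism.Build G G conj_left conj_left_morph.
End ConjLeft.

Section ProdGroup.
Variables (I : Type) (K : I -> groupType).

Definition prod_group := forall i, K i.
HB.instance Definition _ := Choice.on prod_group.

Definition pg_one : prod_group := fun=> 1.
Definition pg_mul (a b : prod_group) : prod_group := fun i => a i * b i.
Definition pg_inv (a : prod_group) : prod_group := fun i => (a i)^-1.

Fact pg_mulA : associative pg_mul.
Proof. by move=> a b c; apply: functional_extensionality_dep => i; exact: mulgA. Qed.
Fact pg_mul1 : left_id pg_one pg_mul.
Proof. by move=> a; apply: functional_extensionality_dep => i; exact: mul1g. Qed.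
Fact pg_1mul : right_id pg_one pg_mul.
Proof. by move=> a; apply: functional_extensionality_dep => i; exact: mulg1. Qed.
Fact pg_mulV : left_inverse pg_one pg_inv pg_mul.
Proof. by move=> a; apply: functional_extensionality_dep => i; exact: mulVg. Qed.
Fact pg_Vmul : right_inverse pg_one pg_inv pg_mul.
Proof. by move=> a; apply: functional_extensionality_dep => i; exact: mulgV. Qed.

HB.instance Definition _ :=
  isGroup.Build prod_group pg_mulA pg_mul1 pg_1mul pg_mulV pg_Vmul.
End ProdGroup.

Section OutGenerators.
Variables (n : nat) (G : groupType) (G_ : 'I_n -> groupType).
Variable iota : forall i, {hom G_ i -> G}.
Hypothesis splitG : is_free_product iota.

Section PartialConj.
Variables (i j : 'I_n) (hij : i != j).

Definition pconj_on (g : G_ i) (k : 'I_n) : {hom G_ k -> G} :=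
  if k == j then (conj_left (iota i g) \o iota k : {hom G_ k -> G}) else iota k.

Definition pconj_fun (g : G_ i) : G -> G := fp_ext splitG (pconj_on g).

HB.instance Definition _ g := isUMagmaMorphism.Build G G (pconj_fun g)
  (fp_ext_morph splitG (pconj_on g)).

Lemma pconj_fun_eq g x : pconj_fun g (iota j x) = iota i g * iota j x * (iota i g)^-1.
Proof. by rewrite /pconj_fun fp_extE /pconj_on eqxx. Qed.

Lemma pconj_fun_neq g k x : k != j -> pconj_fun g (iota k x) = iota k x.
Proof. by move=> /negPf kj; rewrite /pconj_fun fp_extE /pconj_on kj. Qed.

Lemma pconj_funM g h : pconj_fun h \o pconj_fun g =1 pconj_fun (g * h).
Proof.
apply: (@hom_eq_on_factors _ _ _ _ splitG _
  (pconj_fun h \o pconj_fun g) (pconj_fun (g * h))) => k x /=.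
have [kj|kj] := eqVneq k j; last by rewrite !pconj_fun_neq.
case: k / {kj}(esym kj) x => x; rewrite !pconj_fun_eq !(gmulfM, gmulfV).
by rewrite /= pconj_fun_eq pconj_fun_neq // invgM !mulgA.
Qed.

Lemma pconj_fun1 : pconj_fun 1 =1 id.
Proof.
apply: (@hom_eq_on_factors _ _ _ _ splitG _
  (pconj_fun 1) (@idfun G)) => k x /=.
have [kj|kj] := eqVneq k j; last by rewrite pconj_fun_neq.
case: k / {kj}(esym kj) x => x.
by rewrite pconj_fun_eq gmulf1 mul1g invg1 mulg1.
Qed.

Fact pconj_subproof g : is_aut (pconj_fun g).
Proof.
apply/asboolP; split; first exact: gmulfM.
exists (pconj_fun g^-1) => x.
  by rewrite -[LHS]/((_ \o _) x) pconj_funM mulgV pconj_fun1.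
by rewrite -[LHS]/((_ \o _) x) pconj_funM mulVg pconj_fun1.
Qed.

Definition pconj (g : G_ i) : Aut G := MkAut (pconj_subproof g).

Fact pconj_morph : monoid_morphism pconj.
Proof.
split=> [|g h]; apply: autP => x /=; first exact: pconj_fun1.
by rewrite -pconj_funM.
Qed.
HB.instance Definition _ := isUMagmaMorphism.Build (G_ i) (Aut G) pconj pconj_morph.

Definition f_out : {hom G_ i -> Out G} := @out_class G \o pconj.

End PartialConj.

Definition Phi := prod_group (fun i => Aut (G_ i)).
HB.instance Definition _ := Group.on Phi.

Definition factor_on (phi : Phi) (k : 'I_n) : {hom G_ k -> G} := iota k \o phi k.

Definition factor_fun (phi : Phi) : G -> G := fp_ext splitG (factor_on phi).

HB.instance Definition _ phi := isUMagmaMorphism.Build G G (factor_fun phi)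
  (fp_ext_morph splitG (factor_on phi)).

Lemma factor_funE phi k x : factor_fun phi (iota k x) = iota k (phi k x).
Proof. by rewrite /factor_fun fp_extE. Qed.

Lemma factor_funM phi psi :
  factor_fun psi \o factor_fun phi =1 factor_fun (phi * psi).
Proof.
apply: (@hom_eq_on_factors _ _ _ _ splitG _
  (factor_fun psi \o factor_fun phi) (factor_fun (phi * psi))) => k x /=.
by rewrite !factor_funE.
Qed.

Lemma factor_fun1 : factor_fun 1 =1 id.
Proof.
apply: (@hom_eq_on_factors _ _ _ _ splitG _
  (factor_fun 1) (@idfun G)) => k x /=.
by rewrite factor_funE.
Qed.

Fact factor_subproof phi : is_aut (factor_fun phi).
Proof.
apply/asboolP; split; first exact: gmulfM.
exists (factor_fun phi^-1) => x.
  by rewrite -[LHS]/((_ \o _) x) factor_funM mulgV factor_fun1.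
by rewrite -[LHS]/((_ \o _) x) factor_funM mulVg factor_fun1.
Qed.

Definition factor_aut (phi : Phi) : Aut G := MkAut (factor_subproof phi).

Fact factor_aut_morph : monoid_morphism factor_aut.
Proof.
split=> [|phi psi]; apply: autP => x /=; first exact: factor_fun1.
by rewrite -factor_funM.
Qed.
HB.instance Definition _ :=
  isUMagmaMorphism.Build Phi (Aut G) factor_aut factor_aut_morph.

Lemma factor_autP (a : Aut G) :
  (exists phi, a = factor_aut phi) <->
  (forall i, (a @` range (iota i) = range (iota i))%classic).
Proof.
split=> [[phi ->] i|aK].
  apply/seteqP; split=> [_ [_ [x _ <-] <-]|_ [x _ <-]].
    by exists (phi i x) => //; rewrite -factor_funE.
  exists (iota i ((phi i)^-1 x)); first by exists ((phi i)^-1 x).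
  by rewrite -[LHS]/(factor_fun _ _) factor_funE /= aut_inv_funK.
have ex i x : exists y, iota i y = a (iota i x).
  have [] : range (iota i) (a (iota i x)).
    by rewrite -aK; exists (iota i x) => //; exists x.
  by move=> y _ <-; exists y.
pose f i x := sval (cid (ex i x)).
have fE i x : iota i (f i x) = a (iota i x) by rewrite /f; case: cid.
have faut i : is_aut (f i).
  apply/asboolP; split=> [x y|].
    by apply: (is_free_product_inj splitG); rewrite gmulfM !fE !gmulfM.
  have ex' y : exists x, f i x = y.
    have [_ [x _ <-] axy] : (a @` range (iota i))%classic (iota i y).
      by rewrite aK; exists y.
    by exists x; apply: (is_free_product_inj splitG); rewrite fE.
  have finj : injective (f i).
    move=> x y /(congr1 (iota i)); rewrite !fE.
    by move/(bij_inj (aut_bij a))/(is_free_product_inj splitG).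
  exists (fun y => sval (cid (ex' y))) => x; last by case: cid.
  by apply: finj; case: cid.
exists (fun i => MkAut (faut i)); apply: autP.
apply: (@hom_eq_on_factors _ _ _ _ splitG _ a (factor_fun _)) => i x.
by rewrite /= factor_funE /= fE.
Qed.

Definition Phi_out : {hom Phi -> Out G} := @out_class G \o factor_aut.

Definition Ad (i : 'I_n) (g : G_ i) : Phi :=
  dfwith (fun k => 1 : Aut (G_ k)) (inn g).

Definition offdiag := {p : 'I_n * 'I_n | p.1 != p.2}.

(* Some (i, j) indexes the image of f_out (i, j) in Out G, None indexes Phi. *)
Definition gen_group (s : option offdiag) : groupType :=
  if s is Some p then hom_image (f_out (valP p)) else Phi.

Definition gen_map (s : option offdiag) : {hom gen_group s -> Out G} :=
  match s with
  | Some p => @image_val _ _ (f_out (valP p))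
  | None => Phi_out
  end.

Definition gen_f (i j : 'I_n) (hij : i != j) (g : G_ i) : free_prod gen_group :=
  let p : offdiag := exist _ (i, j) hij in
  @fp_in _ gen_group (Some p) (to_image (f_out (valP p)) g).

Definition gen_Phi (phi : Phi) : free_prod gen_group := @fp_in _ gen_group None phi.

(* An equation u = v is represented by the relator u / v. *)
Inductive out_relators : set (free_prod gen_group) :=
| out_rel1 i j k (hij : i != j) (hik : i != k) (g h : G_ i) of j != k :
    out_relators [~ gen_f hij g, gen_f hik h]
| out_rel2 i j k l (hij : i != j) (hkl : k != l) (g : G_ i) (h : G_ k)
    of uniq [:: i; j; k; l] :
    out_relators [~ gen_f hij g, gen_f hkl h]
| out_rel3 i j k (hjk : j != k) (hij : i != j) (hik : i != k)
    (g : G_ j) (h : G_ i) :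
    out_relators [~ gen_f hjk g, gen_f hij h * gen_f hik h]
| out_rel4 i (v : seq {j : 'I_n | i != j}) (g : G_ i)
    of uniq v & (forall j, j \in v) :
    out_relators (\prod_(j <- v) gen_f (valP j) g / gen_Phi (Ad g))
| out_rel5 i j (hij : i != j) (g : G_ i) (phi : Phi) :
    out_relators ((gen_Phi phi)^-1 * gen_f hij g * gen_Phi phi / gen_f hij (phi i g)).

End OutGenerators.

Arguments gen_map {n G G_ iota} splitG s.
Arguments out_relators {n G G_ iota} splitG.

(* Main.v *)
(** An automorphism [a] of [G] permutes the conjugacy classes of the factors
    (Kurosh), and since the factors are pairwise non-isomorphic it maps each
    [G_j] onto a conjugate [u_j G_j u_j^-1]; thus [a] is recorded, up to [Phi],
    by the vertices [v_j = u_j G_j] of the Bass-Serre tree.  Multiplying [a] by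
    [f_ij g] on the left rotates [v_j] about [v_i] and leaves the other vertices
    in place.  Among all these rotations exactly one removes [v_i] from the
    geodesic from the base point to [v_j], and it is the only one that can bring
    [v_j] closer.  If no such rotation shortens the total distance of the [v_j]
    to the base point, a normal form argument shows that all [v_j] are adjacent
    to the base point, i.e. [a] lies in [Phi].  So the [f_ij] and [Phi] generate.

    For the relations, reducing [a] to [Phi] step by step assigns to [a] an
    element of the presented group.  By Noetherian induction on the total
    distance it suffices to compare two reducing rotations of the same [a].
    They commute by relation 1 or 2, unless [v_i] and [v_k] both lie on the
    geodesic to some [v_j]; then relation 3 connects the two results below the
    height of [a].  The resulting map on [Aut G] is a morphism by relation 5,
    and relation 4 says exactly that it kills the inner automorphisms. *)

From HB Require Import structures.
Require Import Defs.
From mathcomp Require Import all_boot.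
From mathcomp Require Import boolp classical_sets functions cardinality.
From mathcomp Require ssralg ssrint.
From mathcomp Require Import zify.

Set Implicit Arguments.
Unset Strict Implicit.
Unset Printing Implicit Defensive.

Local Open Scope group_scope.

(** * Normal forms in free products *)

Lemma ex_argmin (T : Type) (P : T -> Prop) (f : T -> nat) :
  (exists x, P x) -> exists x, P x /\ forall y, P y -> (f x <= f y)%N.
Proof.
move=> [x Px]; have [m] := ubnP (f x); elim: m x Px => // m IH x Px fx.
have [[y [Py fy]]|nex] := pselect (exists y, P y /\ (f y < f x)%N).
  by apply: (IH y) => //; apply: leq_trans fy _.
exists x; split=> // y Py; rewrite leqNgt; apply/negP => fy.
by apply: nex; exists y.
Qed.

Section ReducedWords.
Variables (I : choiceType) (K : I -> groupType).
Implicit Types (i j : I) (w u v : fp_word K).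

Definition starts i w := if w is t :: _ then tag t == i else false.
Definition ends i w := starts i (rev w).

Fixpoint reduced w :=
  if w is t :: w' then [&& tagged t != 1, ~~ starts (tag t) w' & reduced w']
  else true.

(** Van der Waerden's method: each factor acts on reduced words, merging its letter into a first
    letter of the same factor. [untag] only casts that letter to [K i]; its default 1 is never
    reached because [tag t == i]. *)
Definition mulw i (a : K i) w : fp_word K :=
  if a == 1 then w else
  if w is t :: w' then
    if tag t == i then
      let b := a * untag 1 (id : K i -> K i) t in
      if b == 1 then w' else Tagged K b :: w'
    else Tagged K a :: w
  else [:: Tagged K a].

Lemma untagTagged i (a : K i) : untag 1 (id : K i -> K i) (Tagged K a) = a.
Proof. by rewrite (@untagE _ _ _ _ _ _ (Tagged K a) (erefl i)). Qed.

Lemma mulw1 i w : mulw (1 : K i) w = w.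
Proof. by rewrite /mulw eqxx. Qed.

Lemma mulw_cons i (a : K i) w : a != 1 -> ~~ starts i w ->
  mulw a w = Tagged K a :: w.
Proof.
by rewrite /mulw => /negPf->; case: w => //= t w /negPf->.
Qed.

Lemma mulw_merge i (a b : K i) w : b != 1 ->
  mulw a (Tagged K b :: w) = if a * b == 1 then w else Tagged K (a * b) :: w.
Proof.
move=> b1; rewrite /mulw; case: eqP => [->|_] /=; last by rewrite eqxx untagTagged.
by rewrite mul1g (negPf b1).
Qed.

Lemma startsP i w : reflect (exists b w', w = Tagged K (b : K i) :: w') (starts i w).
Proof.
apply: (iffP idP) => [|[b [w' ->]]]; last by rewrite /= eqxx.
by case: w => // -[k b] w /= /eqP e; case: i / e; exists b, w.
Qed.

Lemma mulw_reduced i (a : K i) w : reduced w -> reduced (mulw a w).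
Proof.
move=> rw; have [->|a1] := eqVneq a 1; first by rewrite mulw1.
case: (boolP (starts i w)) => [/startsP[b [w' E]]|nsw].
  move: rw; rewrite {}E => /= /and3P[b1 sw' rw'].
  rewrite mulw_merge //; case: eqP => //= /eqP ab1; by rewrite ab1 sw'.
by rewrite mulw_cons //= a1 nsw.
Qed.

Lemma mulwM i (a b : K i) w : reduced w -> mulw a (mulw b w) = mulw (a * b) w.
Proof.
move=> rw; have [->|a1] := eqVneq a 1; first by rewrite mulw1 mul1g.
have [->|b1] := eqVneq b 1; first by rewrite mulw1 mulg1.
case: (boolP (starts i w)) => [/startsP[c [w' E]]|nsw].
  move: rw; rewrite {}E => /= /and3P[c1 sw' rw'].
  rewrite !mulw_merge // -!mulgA; case: eqP => [->|/eqP bc1].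
    by rewrite mulg1 (negPf a1) mulw_cons.
  by rewrite mulw_merge.
rewrite (mulw_cons b1 nsw) mulw_merge //; case: eqP => [->|/eqP ab1].
  by rewrite mulw1.
by rewrite mulw_cons.
Qed.

Definition nf w : fp_word K := foldr (fun t v => mulw (tagged t) v) [::] w.

Lemma nf_reduced w : reduced (nf w).
Proof. by elim: w => //= t w IH; apply: mulw_reduced. Qed.

(** Both defining moves of [fp_eq] leave [nf] unchanged because [mulw] is an action of each factor
    on reduced words. Hence normal forms are unique. *)
Lemma nf_eq w w' : fp_eq w w' -> nf w = nf w'.
Proof.
rewrite /nf; elim=> {w w'} [w|w w' _ ->|w w' w'' _ -> _ ->|u v i|u v i x y] //.
  by rewrite !foldr_cat /= mulw1.
by rewrite !foldr_cat /= mulwM //; apply: nf_reduced.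
Qed.

Lemma nf_id w : reduced w -> nf w = w.
Proof.
by elim: w => //= -[i a] w IH /= /and3P[a1 sw rw]; rewrite IH // mulw_cons.
Qed.

Lemma mulw_eq i (a : K i) w : fp_eq (mulw a w) (Tagged K a :: w).
Proof.
have [->|a1] := eqVneq a 1.
  rewrite mulw1; apply: fp_sym; exact: (fp_one [::]).
rewrite /mulw (negPf a1); case: w => [|[k b] w] /=; first exact: fp_refl.
case: eqP => [e|_]; last exact: fp_refl.
case: i / e a a1 => a a1; rewrite untagTagged.
case: eqP => [ab|_].
  apply: fp_sym; apply: fp_trans (fp_mul [::] _ _ _) _; rewrite ab.
  exact: (fp_one [::]).
apply: fp_sym; exact: (fp_mul [::]).
Qed.

Lemma nf_fp_eq w : fp_eq (nf w) w.
Proof.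
elim: w => [|[i a] w IH]; first exact: fp_refl.
apply: fp_trans (mulw_eq _ _) _.
exact: (fp_eq_cat (fp_refl [:: Tagged K a]) IH).
Qed.

Lemma size_mulw i (a : K i) w : (size (mulw a w) <= (size w).+1)%N.
Proof.
rewrite /mulw; case: eqP => // _; case: w => //= t w.
by case: ifP => //= _; case: eqP => _ //=; apply: leqW.
Qed.

Lemma size_nf w : (size (nf w) <= size w)%N.
Proof. by elim: w => //= t w IH; apply: leq_trans (size_mulw _ _) _. Qed.

Lemma starts_cat i u v : starts i (u ++ v) = if u is [::] then starts i v else starts i u.
Proof. by case: u. Qed.

Lemma ends_rcons i u t : ends i (rcons u t) = (tag t == i).
Proof. by rewrite /ends rev_rcons. Qed.

Lemma ends_cons i t s u : ends i (t :: s :: u) = ends i (s :: u).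
Proof. by case/lastP: u => [|u x]; rewrite ?ends_rcons -?rcons_cons ?ends_rcons. Qed.

Lemma endsP i w : reflect (exists w' b, w = rcons w' (Tagged K (b : K i))) (ends i w).
Proof.
apply: (iffP idP) => [|[w' [b ->]]]; last by rewrite ends_rcons.
case/startsP => b [w' E]; exists (rev w'), b.
by rewrite -[w]revK E rev_cons.
Qed.

Lemma reduced_cat_cons u t v : reduced (u ++ t :: v) =
  [&& reduced u, reduced (t :: v) & ~~ ends (tag t) u].
Proof.
elim: u => [|s u IH]; first by rewrite /= andbT.
rewrite cat_cons [LHS]/= IH starts_cat; case: u IH => [|r u] IH.
  rewrite /ends /= [tag t == _]eq_sym !andbT.
  by case: (tagged s != 1) => //=; rewrite andbC.
by rewrite ends_cons /= -!andbA.
Qed.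

End ReducedWords.

Section NormalForm.
Variables (I : choiceType) (K : I -> groupType) (G : groupType).
Variable iota : forall i, {hom K i -> G}.
Hypothesis splitG : is_free_product iota.
Implicit Types (i j : I) (w u v : fp_word K) (g x y : G).

Fact iotaM i (a b : K i) : iota i (a * b) = iota i a * iota i b.
Proof. exact: gmulfM. Qed.

Definition gnf g : fp_word K := nf (fp_repr (fp_coord splitG g)).

Lemma gnf_reduced g : reduced (gnf g).
Proof. exact: nf_reduced. Qed.

Lemma gnf_class g : fp_class (gnf g) = fp_coord splitG g.
Proof.
by rewrite -[RHS]fp_reprK; apply/fp_classP; apply: nf_fp_eq.
Qed.

Lemma gnfK g : fp_eval iota (gnf g) = g.
Proof. by rewrite -fp_liftE gnf_class fp_coordK. Qed.

Lemma gnf_eval w : gnf (fp_eval iota w) = nf w.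
Proof.
rewrite /gnf; apply: nf_eq; apply/fp_classP.
by rewrite fp_reprK -fp_liftE fp_liftK.
Qed.

Lemma eval_nil : fp_eval iota [::] = 1.
Proof. by rewrite /fp_eval big_nil. Qed.

Lemma eval_cons i (a : K i) w :
  fp_eval iota (Tagged K a :: w) = iota i a * fp_eval iota w.
Proof. by rewrite /fp_eval big_cons. Qed.

Lemma eval_cat u v : fp_eval iota (u ++ v) = fp_eval iota u * fp_eval iota v.
Proof. by rewrite /fp_eval big_cat. Qed.

Lemma gnf_mul i (a : K i) g : gnf (iota i a * g) = mulw a (gnf g).
Proof.
rewrite -{1}(gnfK g) -eval_cons gnf_eval /= nf_id //; exact: gnf_reduced.
Qed.

Lemma gnf1 : gnf 1 = [::].
Proof. by rewrite -eval_nil gnf_eval. Qed.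

Lemma group_ind (P : G -> Prop) : P 1 ->
  (forall i (a : K i) g, P g -> P (iota i a * g)) -> forall g, P g.
Proof.
move=> P1 PM g; rewrite -(gnfK g); elim: (gnf g) => [|[i a] w IH].
  by rewrite eval_nil.
by rewrite -[existT _ _ _]/(Tagged K a) eval_cons; apply: PM.
Qed.

Definition len g := size (gnf g).

Lemma len_eval w : (len (fp_eval iota w) <= size w)%N.
Proof. by rewrite /len gnf_eval size_nf. Qed.

Lemma len1 : len 1 = 0%N. Proof. by rewrite /len gnf1. Qed.

Lemma len0_eq g : len g = 0%N -> g = 1.
Proof. by move/size0nil => E; rewrite -(gnfK g) E eval_nil. Qed.

Lemma lenM x y : (len (x * y) <= len x + len y)%N.
Proof.
by rewrite -{1}(gnfK x) -{1}(gnfK y) -eval_cat (leq_trans (len_eval _)) // size_cat.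
Qed.

Lemma len_in i (a : K i) : (len (iota i a) <= 1)%N.
Proof. by rewrite -[iota i a]mulg1 -eval_nil -eval_cons len_eval. Qed.

Lemma len_shorten g : len g != 0%N ->
  exists i (a : K i) h, [/\ g = h * iota i a, (len h < len g)%N & ends i (gnf g)].
Proof.
rewrite /len size_eq0; case/lastP E: (gnf g) => [//|w [i a]] _.
exists i, a, (fp_eval iota w); split.
- rewrite -{1}(gnfK g) E -cats1 eval_cat -[existT _ _ _]/(Tagged K a).
  by rewrite eval_cons eval_nil mulg1.
- by rewrite size_rcons ltnS; apply: len_eval.
- by rewrite ends_rcons.
Qed.

Lemma lenV x : len x^-1 = len x.
Proof.
have le y : (len y^-1 <= len y)%N.
  have <- : fp_eval iota (fp_word_inv (gnf y)) = y^-1.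
    apply: (@mulIg _ y); rewrite mulVg -{2}(gnfK y) -eval_cat -eval_nil.
    exact/fp_eval_eq/fp_word_invP.
  by rewrite (leq_trans (len_eval _)) // size_rev size_map.
by apply/eqP; rewrite eqn_leq le -{1}(invgK x) le.
Qed.

(** Says that g is shortest in its coset by the factor i on the right; by [minr_ends] and
    [ends_minr], its normal form then does not end in that factor, and conversely. *)
Definition minr i g := forall a : K i, (len g <= len (g * iota i a))%N.
Definition minl i g := forall a : K i, (len g <= len (iota i a * g))%N.

Lemma minr_ends i g : minr i g -> ~~ ends i (gnf g).
Proof.
move=> m; apply/negP => /endsP[w [b E]].
have := m b^-1; rewrite {1}/len E size_rcons leqNgt => /negP; apply.
rewrite -(gnfK g) E -cats1 eval_cat eval_cons eval_nil mulg1 -mulgA -gmulfM.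
by rewrite mulgV gmulf1 mulg1 ltnS len_eval.
Qed.

Lemma minl_starts i g : minl i g -> ~~ starts i (gnf g).
Proof.
move=> m; apply/negP => /startsP[b [w E]].
have := m b^-1; rewrite {1}/len E leqNgt => /negP; apply.
rewrite -(gnfK g) E eval_cons mulgA -gmulfM.
by rewrite mulVg gmulf1 mul1g ltnS len_eval.
Qed.

Lemma reduced_gnf w : reduced w -> gnf (fp_eval iota w) = w.
Proof. by move=> rw; rewrite gnf_eval nf_id. Qed.

Lemma ends_minr i w : reduced w -> ~~ ends i w -> minr i (fp_eval iota w).
Proof.
move=> rw nw c; have [->|c1] := eqVneq c 1; first by rewrite gmulf1 mulg1.
rewrite /len reduced_gnf // -[iota i c]mulg1 -eval_nil -eval_cons -eval_cat.
rewrite reduced_gnf ?size_cat ?leq_addr //.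
by rewrite reduced_cat_cons rw /= c1 nw.
Qed.

(** The concatenation is already reduced: [a] is non-trivial and neither neighbour of it lies in the
    factor i. The disjunction serves the case y = 1, where [a] is the last letter and must not lie
    in the factor j. *)
Lemma gnf_concat i j g y (a : K i) : minr i g -> minl i y -> minr j y ->
  (i != j) || (y != 1) -> a != 1 ->
  gnf (g * iota i a * y) = gnf g ++ Tagged K a :: gnf y /\
  minr j (g * iota i a * y).
Proof.
move=> mg my my' ij a1; have rw : reduced (gnf g ++ Tagged K a :: gnf y).
  by rewrite reduced_cat_cons gnf_reduced (minr_ends mg) /= a1 gnf_reduced minl_starts.
have E : g * iota i a * y = fp_eval iota (gnf g ++ Tagged K a :: gnf y).
  by rewrite eval_cat eval_cons !gnfK mulgA.
split; first by rewrite E reduced_gnf.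
rewrite E; apply: ends_minr => //.
have := minr_ends my'; case/lastP Ey: (gnf y) => [|v t]; last first.
  by rewrite -rcons_cons -rcons_cat !ends_rcons.
move=> _; rewrite cats1 ends_rcons /=; case/orP: ij => // /eqP[].
by rewrite -(gnfK y) Ey eval_nil.
Qed.

Lemma len_concat i j g y (a : K i) : minr i g -> minl i y -> minr j y ->
  (i != j) || (y != 1) -> a != 1 ->
  len (g * iota i a * y) = (len g + len y).+1.
Proof.
move=> mg my my' ij a1; have [E _] := gnf_concat mg my my' ij a1.
by rewrite {1}/len E size_cat /= addnS.
Qed.

Lemma minr_unique i g (a : K i) : minr i g -> minr i (g * iota i a) -> a = 1.
Proof.
move=> m m'; apply/eqP/negP => /negP a1.
have := minr_ends m'.
rewrite -{1}(gnfK g) -[iota i a]mulg1 -eval_nil -eval_cons -eval_cat.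
rewrite reduced_gnf ?cats1 ?ends_rcons ?eqxx //.
by rewrite -cats1 reduced_cat_cons gnf_reduced /= a1 minr_ends.
Qed.

Lemma ex_minr i g : exists a : K i, minr i (g * iota i a).
Proof.
have [a [_ am]] := @ex_argmin (K i) (fun=> True) (fun a => len (g * iota i a))
   (ex_intro _ 1 Logic.I).
by exists a => b; rewrite -mulgA -gmulfM am.
Qed.

Lemma ex_min2 i j g : exists (a : K i) (b : K j),
  forall c d, (len (iota i a * g * iota j b) <= len (iota i c * g * iota j d))%N.
Proof.
have [p [_ pm]] := @ex_argmin (K i * K j)%type (fun=> True)
  (fun p => len (iota i p.1 * g * iota j p.2)) (ex_intro _ (1, 1) Logic.I).
by exists p.1, p.2 => c d; apply: (pm (c, d)).
Qed.

(** Malnormality of a factor. Write g as c^-1 y d^-1 with y shortest in its double coset. If y were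
    not 1, the conjugate of c a c^-1 by y would be reduced as written, of length 2 len(y) + 1; but
    it lies in the factor, so its length is at most 1. *)
Lemma factor_malnormal i g (a b : K i) : a != 1 ->
  g^-1 * iota i a * g = iota i b -> exists c, g = iota i c.
Proof.
move=> a1 E; have [c [d m]] := ex_min2 i i g.
set y := iota i c * g * iota i d in m.
have gE : g = iota i c^-1 * y * iota i d^-1.
  by rewrite /y !gmulfV !mulgA mulVg mul1g mulgK.
have [y1|y1] := eqVneq y 1.
  by exists (c^-1 * d^-1); rewrite gE y1 mulg1 gmulfM.
have my : minl i y by move=> e; rewrite /y !mulgA -iotaM; apply: m.
have my' : minr i y by move=> e; rewrite /y -[_ * iota i e]mulgA -iotaM; apply: m.
have myV : minr i y^-1.
  by move=> e; rewrite -(invgK e) gmulfV -invgM !lenV; apply: my.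
have a'1 : c * a * c^-1 != 1.
  by rewrite -(inj_eq (@mulIg _ c)) mulgVK mul1g -{2}(mulg1 c) (inj_eq (@mulgI _ c)).
have := len_concat myV my my' _ a'1; rewrite y1 orbT => /(_ isT).
suff -> : y^-1 * iota i (c * a * c^-1) * y = iota i (d^-1 * b * d).
  move=> H; have := len_in (d^-1 * b * d); rewrite H lenV ltnS leqn0 addn_eq0.
  by case/andP=> /eqP/len0_eq y0; rewrite y0 eqxx in y1.
by rewrite gE in E; rewrite !gmulfM -E !gmulfV !(invgM, invgK, mulgA) !(mulgVK, mulgK).
Qed.

End NormalForm.

(** * The Kurosh subgroup theorem for indecomposable subgroups *)

Section SchreierTransversal.
Variables (I : choiceType) (K : I -> groupType) (G : groupType).
Variable iota : forall i, {hom K i -> G}.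
Hypothesis splitG : is_free_product iota.
Variables (H : groupType) (jH : {hom H -> G}).

Definition inH g := exists h, jH h = g.

Lemma inH1 : inH 1. Proof. by exists 1; rewrite gmulf1. Qed.
Lemma inHM x y : inH x -> inH y -> inH (x * y).
Proof. by move=> [h <-] [k <-]; exists (h * k); rewrite gmulfM. Qed.
Lemma inHV x : inH x -> inH x^-1.
Proof. by move=> [h <-]; exists h^-1; rewrite gmulfV. Qed.

(** The coset Hx and, next, the double coset HxG_i. They are kept as sets because the choices made
    below by [xget] depend on x only through these sets, so that equal cosets receive equal
    choices. *)
Definition cos x : set G := [set y | inH (y * x^-1)].
Definition dcos i x : set G := [set y | exists a : K i, inH (y * iota i a * x^-1)].

Lemma cos_refl x : cos x x. Proof. by rewrite /cos /= mulgV; exact: inH1. Qed.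

Lemma cos_eq x y : cos x y -> cos y = cos x.
Proof.
move=> xy; apply/seteqP; split=> z /= zy.
  by have := inHM zy xy; rewrite mulgA mulgVK.
by have := inHM zy (inHV xy); rewrite invgM invgK mulgA mulgVK.
Qed.

Lemma cos_mul x y g : cos x y -> cos (x * g) (y * g).
Proof. by rewrite /cos /= invgM !mulgA mulgK. Qed.

Lemma cos_sym x y : cos x y -> cos y x.
Proof. by move=> /cos_eq ->; apply: cos_refl. Qed.

Lemma cos_trans y x z : cos x y -> cos y z -> cos x z.
Proof. by move=> /cos_eq ->. Qed.

Lemma dcos_eq i x y : dcos i x y -> dcos i y = dcos i x.
Proof.
move=> [a xy]; apply/seteqP; split=> z [b] zy.
  exists (b * a); apply: (@cos_trans (y * iota i a)) => //.
  by rewrite gmulfM mulgA; apply: cos_mul.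
exists (b * a^-1); rewrite gmulfM mulgA -(mulgK (iota i a) y) gmulfV.
by apply: cos_mul; apply: (cos_trans (cos_sym xy)).
Qed.

Lemma cos_dcos i x y : cos x y -> dcos i x y.
Proof. by move=> xy; exists 1; rewrite gmulf1 mulg1. Qed.

Definition clen x := len splitG
  (xget 1 [set y | cos x y /\ forall z, cos x z -> (len splitG y <= len splitG z)%N]).

Definition base i x :=
  xget 1 [set y | dcos i x y /\ forall z, dcos i x z -> (clen y <= clen z)%N].

(** Leads from the base point of HxG_i to the coset Hx. The second clause normalises it to 1 when Hx
    is the coset of the base point itself. *)
Definition gam i x : K i :=
  xget 1 [set a | cos x (base i x * iota i a) /\ (cos x (base i x) -> a = 1)].

(** The direction of the parent of Hx in the transversal tree: a factor whose base point has a
    strictly shorter coset, and [None] at the root. *)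
Definition par x : option I :=
  xget None [set o | exists i, o = Some i /\ (clen (base i x) < clen x)%N].

Fixpoint trv k x :=
  if k is k'.+1 then
    if par x is Some i then trv k' (base i x) * iota i (gam i x) else 1
  else 1.

(* [rho x] represents the coset Hx in a Schreier transversal of H\G: the last
   letter of [rho x] is removed by passing to the base point of some HxG_i. *)
Definition rho x := trv (clen x) x.

Definition tau i x := rho (base i x).

Lemma clenP x : exists y, [/\ cos x y, len splitG y = clen x &
  forall z, cos x z -> (clen x <= len splitG z)%N].
Proof.
rewrite /clen; set P := (X in xget 1 X); exists (xget 1 P).
suff [xP Pmin] : P (xget 1 P) by [].
by apply: xgetPex; apply: ex_argmin; exists x; apply: cos_refl.
Qed.

Lemma baseP i x : dcos i x (base i x) /\
  forall z, dcos i x z -> (clen (base i x) <= clen z)%N.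
Proof.
rewrite /base; set P := (X in xget 1 X); suff : P (xget 1 P) by [].
apply: xgetPex; apply: ex_argmin; exists x; apply: cos_dcos; exact: cos_refl.
Qed.

Lemma gamP i x : cos x (base i x * iota i (gam i x)) /\
  (cos x (base i x) -> gam i x = 1).
Proof.
rewrite /gam; set P := (X in xget 1 X); suff : P (xget 1 P) by [].
apply: xgetPex; have [[a xa] _] := baseP i x.
have [xb|nxb] := pselect (cos x (base i x)); last by exists a; split.
by exists 1; split=> //; rewrite gmulf1 mulg1.
Qed.

Lemma clen_cos x y : cos x y -> clen y = clen x.
Proof. by rewrite /clen => /cos_eq ->. Qed.

Lemma base_dcos i x y : dcos i x y -> base i y = base i x.
Proof. by rewrite /base => /dcos_eq ->. Qed.

Lemma base_cos i x y : cos x y -> base i y = base i x.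
Proof. by move/(cos_dcos i)/base_dcos. Qed.

Lemma gam_cos i x y : cos x y -> gam i y = gam i x.
Proof. by move=> xy; rewrite /gam (base_cos _ xy) (cos_eq xy). Qed.

Lemma par_cos x y : cos x y -> par y = par x.
Proof.
move=> xy; rewrite /par (clen_cos xy); congr xget; apply/seteqP.
by split=> o [i [-> lt]]; exists i; [rewrite -(base_cos _ xy)|rewrite (base_cos _ xy)].
Qed.

Lemma trv_cos k x y : cos x y -> trv k y = trv k x.
Proof.
case: k => //= k xy; rewrite (par_cos xy); case: (par x) => // i.
by rewrite (base_cos _ xy) (gam_cos _ xy).
Qed.

Lemma rho_cos x y : cos x y -> rho y = rho x.
Proof. by move=> xy; rewrite /rho (clen_cos xy) (trv_cos _ xy). Qed.

Lemma parP x i : par x = Some i -> (clen (base i x) < clen x)%N.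
Proof.
by rewrite /par; case: xgetP => // o -> [k [-> lt]] [<-].
Qed.

(** Dropping the last letter, say in the factor i, of a shortest element of Hx yields a strictly
    shorter coset inside HxG_i. *)
Lemma par_ex x : clen x != 0%N -> exists i, par x = Some i.
Proof.
move=> x0; have [y [xy yl ymin]] := clenP x; rewrite -yl in x0.
have [i [a [z [yE zl _]]]] := len_shorten x0.
rewrite /par; case: xgetP => [_ _ [i' [-> _]]|/(_ (Some i)) []]; first by exists i'.
exists i; split=> //; have [_ bm] := baseP i x.
have dz : dcos i x z by exists a; rewrite -yE.
apply: leq_ltn_trans (bm _ dz) _; rewrite -yl; apply: leq_ltn_trans zl.
by have [_ [_ _]] := clenP z; apply; apply: cos_refl.
Qed.

Lemma rho_clen0 x : clen x = 0%N -> rho x = 1.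
Proof. by rewrite /rho => ->. Qed.

Lemma par_clen0 x : clen x = 0%N -> par x = None.
Proof. by move=> x0; case E: (par x) => [i|//]; have := parP E; rewrite x0. Qed.

Lemma trv_fuel k k' x : (clen x <= k)%N -> (clen x <= k')%N -> trv k x = trv k' x.
Proof.
elim: k k' x => [|k IH] k' x xk xk'.
  by move: xk; rewrite leqn0; case: k' xk' => //= k' _ /eqP/par_clen0 ->.
case: k' xk' => [|k'] xk'; first by move: xk'; rewrite leqn0 /= => /eqP/par_clen0 ->.
rewrite /=; case E: (par x) => [i|//]; have lt := parP E.
by rewrite (IH k') // -ltnS; apply: leq_trans lt _.
Qed.

Lemma rho_rec x : clen x != 0%N -> exists i,
  rho x = tau i x * iota i (gam i x) /\ (clen (base i x) < clen x)%N.
Proof.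
move=> x0; have [i E] := par_ex x0; have lt := parP E; exists i; split=> //.
rewrite /rho (@trv_fuel _ (clen x).+1) //= E; congr (_ * _).
by rewrite /tau /rho; apply: trv_fuel => //; apply: ltnW.
Qed.

Lemma rhoP x : cos x (rho x).
Proof.
have [m] := ubnP (clen x); elim: m x => // m IH x xm.
have [x0|x0] := eqVneq (clen x) 0%N.
  rewrite rho_clen0 //; have [y [xy yl _]] := clenP x.
  by rewrite -(@len0_eq _ _ _ _ splitG y) // yl.
have [i [-> lt]] := rho_rec x0; have [xb _] := gamP i x.
by apply: cos_trans xb _; apply: cos_mul; apply: IH; apply: leq_trans lt _.
Qed.

Lemma rho1 : rho 1 = 1.
Proof.
apply: rho_clen0; have [y [_ _ ymin]] := clenP 1.
by apply/eqP; rewrite -leqn0 -(len1 splitG) ymin //; apply: cos_refl.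
Qed.

Lemma tau_cos i x y : cos x y -> tau i y = tau i x.
Proof. by rewrite /tau => /(base_cos i) ->. Qed.

Lemma tau_dcos i x y : dcos i x y -> tau i y = tau i x.
Proof. by rewrite /tau => /base_dcos ->. Qed.

Lemma rho_tau i x : rho (tau i x) = tau i x.
Proof. by apply: rho_cos; apply: rhoP. Qed.

Lemma dcos_tau i x : dcos i x (tau i x).
Proof. by have [<- _] := (dcos_eq (proj1 (baseP i x)), Logic.I); apply/cos_dcos/rhoP. Qed.

Lemma tau_tau i x : tau i (tau i x) = tau i x.
Proof. exact/tau_dcos/dcos_tau. Qed.

Lemma gam_tau i x : gam i (tau i x) = 1.
Proof.
have [_ -> //] := gamP i (tau i x).
by rewrite (base_dcos (dcos_tau i x)); apply/cos_sym/rhoP.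
Qed.

Lemma tau_gam i x : cos x (tau i x * iota i (gam i x)).
Proof. have [xb _] := gamP i x; apply: cos_trans xb _; exact/cos_mul/rhoP. Qed.

Lemma dcos_mul i x (a : K i) : dcos i x (x * iota i a).
Proof.
by exists a^-1; rewrite gmulfV mulgK; apply: cos_refl.
Qed.

End SchreierTransversal.

(** * Subgroups and infinite cyclic groups as free factors *)

Section Subgroups.
Variable G : groupType.

Record subgroup := Subgroup { sg_pred :> pred G; _ : group_closed sg_pred }.

Record subgroup_type (S : subgroup) := SubgroupElt {
  sg_val :> G; _ : sg_pred S sg_val }.

Variable S : subgroup.
HB.instance Definition _ := [isSub for @sg_val S].
HB.instance Definition _ := [Choice of subgroup_type S by <:].

Fact subgroup_closed : group_closed (sg_pred S).
Proof. by case: S. Qed.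
HB.instance Definition _ :=
  SubChoice_isSubGroup.Build G (sg_pred S) (subgroup_type S) subgroup_closed.

Fact sg_val_morph : monoid_morphism (@sg_val S).
Proof. by split=> [|x y]; [exact: val1 | exact: valM]. Qed.
HB.instance Definition _ :=
  isUMagmaMorphism.Build (subgroup_type S) G (@sg_val S) sg_val_morph.
End Subgroups.

Section IntegerPowers.
Import ssralg ssrint.

Definition Zgroup := int.
HB.instance Definition _ := Choice.on Zgroup.
HB.instance Definition _ := isGroup.Build Zgroup (@GRing.addrA int)
  (@GRing.add0r int) (@GRing.addr0 int) (@GRing.addNr int) (@GRing.addrN int).

Definition Zone : Zgroup := Posz 1.

Lemma Zpos_mul k : (Posz k : Zgroup) * Zone = Posz k.+1.
Proof. by rewrite -[LHS]/(Posz (k + 1)%N) addn1. Qed.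
Lemma Zneg0_mul : (Negz 0 : Zgroup) * Zone = 1.
Proof. by []. Qed.
Lemma Zneg_mul k : (Negz k.+1 : Zgroup) * Zone = Negz k.
Proof. by rewrite -[LHS]/(Negz (k.+1 - 1)%N) subn1. Qed.

Variable G : groupType.
Implicit Types g : G.

Definition zpow g (m : Zgroup) : G :=
  match (m : int) with Posz k => g ^+ k | Negz k => g ^- k.+1 end.

Lemma zpowS g (m : Zgroup) : zpow g (m * Zone) = zpow g m * g.
Proof.
case: m => [k|[|k]].
- by rewrite Zpos_mul /zpow expgSr.
- by rewrite Zneg0_mul /zpow expg1 mulVg.
- by rewrite Zneg_mul /zpow [in RHS]expgS invgM mulgVK.
Qed.

Lemma zpow_is_morph g : monoid_morphism (zpow g).
Proof.
split=> // m n; case: n => k.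
  elim: k m => [|k IH] m.
    by rewrite -[Posz 0]/(1 : Zgroup) mulg1 -[zpow g 1]/(g ^+ 0) expg0 mulg1.
  have -> : Posz k.+1 = (Posz k : Zgroup) * Zone.
    by rewrite Zpos_mul.
  by rewrite mulgA !zpowS IH mulgA.
elim: k m => [|k IH] m.
  apply: (@mulIg _ g); rewrite -zpowS -mulgA Zneg0_mul mulg1.
  by rewrite -[zpow g (Negz 0)]/(g^-1) mulgVK.
apply: (@mulIg _ g); rewrite -zpowS -!mulgA -zpowS.
rewrite Zneg_mul; exact: IH.
Qed.

HB.instance Definition _ g := isUMagmaMorphism.Build Zgroup G (zpow g) (zpow_is_morph g).

Lemma zpow1 g : zpow g Zone = g. Proof. exact: expg1. Qed.

End IntegerPowers.

Section IntegerPowersTheory.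
Import ssrint.

Lemma zpow_Zone (m : Zgroup) : zpow Zone m = m.
Proof.
have E k : Zone ^+ k = Posz k :> Zgroup.
  elim: k => [//|k IH]; rewrite expgSr IH.
  exact: Zpos_mul.
case: m => k; rewrite /zpow E //.
Qed.

Lemma gmulf_zpow (G H : groupType) (f : {hom G -> H}) (g : G) (m : Zgroup) :
  f (zpow g m) = zpow (f g) m.
Proof. by case: m => k; rewrite /zpow /= ?gmulfXVn ?gmulfXn. Qed.

End IntegerPowersTheory.

Section Wreath.
Variables (G L : groupType).

(** Unrestricted wreath product, G acting on functions by right translation. A morphism from G whose
    first component is the identity amounts to a cocycle c with c(x, gh) = c(x, g) c(xg, h). *)
Definition wreath := (G * prod_group (fun _ : G => L))%type.
HB.instance Definition _ := Choice.on wreath.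

Definition wr_one : wreath := (1, fun=> 1).
Definition wr_mul (p q : wreath) : wreath :=
  (p.1 * q.1, fun x => p.2 x * q.2 (x * p.1)).
Definition wr_inv (p : wreath) : wreath :=
  (p.1^-1, fun x => (p.2 (x * p.1^-1))^-1).

Fact wr_eq (p q : wreath) : p.1 = q.1 -> (forall x, p.2 x = q.2 x) -> p = q.
Proof. by case: p q => p1 p2 [q1 q2] /= -> E; congr pair; apply: funext. Qed.

Fact wr_mulA : associative wr_mul.
Proof. by move=> p q r; apply: wr_eq => [|x] /=; rewrite !mulgA. Qed.
Fact wr_mul1 : left_id wr_one wr_mul.
Proof. by move=> p; apply: wr_eq => [|x] /=; rewrite ?mulg1 mul1g. Qed.
Fact wr_1mul : right_id wr_one wr_mul.
Proof. by move=> p; apply: wr_eq => [|x] /=; rewrite mulg1. Qed.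
Fact wr_mulV : left_inverse wr_one wr_inv wr_mul.
Proof. by move=> p; apply: wr_eq => [|x] /=; rewrite mulVg. Qed.
Fact wr_Vmul : right_inverse wr_one wr_inv wr_mul.
Proof. by move=> p; apply: wr_eq => [|x] /=; rewrite ?mulgK mulgV. Qed.

HB.instance Definition _ :=
  isGroup.Build wreath wr_mulA wr_mul1 wr_1mul wr_mulV wr_Vmul.

End Wreath.

(** * The Kurosh decomposition of a subgroup *)

Section Kurosh.
Variables (I : choiceType) (K : I -> groupType) (G : groupType).
Variable iota : forall i, {hom K i -> G}.
Hypothesis splitG : is_free_product iota.
Variables (H : groupType) (jH : {hom H -> G}).
Hypothesis jH_inj : injective jH.

Local Notation cos := (cos jH).
Local Notation dcos := (dcos iota jH).
Local Notation rho := (rho splitG jH).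
Local Notation tau := (tau splitG jH).
Local Notation gam := (gam splitG jH).
Local Notation inH := (inH jH).
Implicit Types (i : I) (x y g : G).

Lemma cos_mulV x y g : cos (x * g) (y * g) -> cos x y.
Proof. by move/(cos_mul g^-1); rewrite !mulgK. Qed.

(* Trivial unless [x] is the chosen base point of the double coset HxG_i. *)
Definition stab_pred (p : I * G) : pred (K p.1) := fun a =>
  `[< a = 1 \/ (tau p.1 p.2 = p.2 /\ cos p.2 (p.2 * iota p.1 a)) >].

Arguments stab_pred : clear implicits.

Fact stab_closed p : group_closed (stab_pred p).
Proof.
split=> [|a b /asboolP Sa /asboolP Sb]; apply/asboolP; first by left.
have [tx|tx] := pselect (tau p.1 p.2 = p.2); last first.
  by left; case: Sa Sb => [->|[] //] [->|[] //]; rewrite divg1.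
have S c : c = 1 \/ (tau p.1 p.2 = p.2 /\ cos p.2 (p.2 * iota p.1 c)) ->
    cos p.2 (p.2 * iota p.1 c).
  by case=> [->|[_]] //; rewrite gmulf1 mulg1; apply: cos_refl.
right; split=> //; have {}Sa := S _ Sa; have {}Sb := S _ Sb.
apply: (@cos_mulV _ _ (iota p.1 b)); rewrite gmulfF mulgA mulgVK.
exact: cos_trans (cos_sym Sb) Sa.
Qed.

(* The edge between the coset Hx and the double coset HxG_i of the quotient of
   the tree by H lies in the maximal tree given by [rho] iff
   [rho x = tau i x * iota i (gam i x)]; only the other edges, each indexed by
   the representative of Hx, contribute an infinite cyclic free factor. *)
Definition edge_pred (p : I * G) : pred Zgroup := fun m =>
  `[< m = 1 \/ (rho p.2 = p.2 /\ p.2 <> tau p.1 p.2 * iota p.1 (gam p.1 p.2)) >].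

Fact edge_closed p : group_closed (edge_pred p).
Proof.
split=> [|a b /asboolP Sa /asboolP Sb]; apply/asboolP; first by left.
case: Sa => [->|]; last by right.
by case: Sb => [->|]; [left; rewrite divg1 | right].
Qed.

(* The free factors of H: vertex stabilisers and edges outside the maximal tree. *)
Definition KJ (j : (I * G) + (I * G)) : groupType :=
  match j with
  | inl p => subgroup_type (Subgroup (stab_closed p))
  | inr p => subgroup_type (Subgroup (edge_closed p))
  end.

Definition pre g : H := xget 1 [set h | jH h = g].

Lemma preK g : inH g -> jH (pre g) = g.
Proof. by move=> hg; rewrite /pre; apply: (@xgetPex _ 1 [set h | jH h = g]). Qed.

Definition stab_fun p (s : subgroup_type (Subgroup (stab_closed p))) : H :=
  pre (p.2 * iota p.1 (val s) * p.2^-1).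

Lemma stab_funE p s : jH (@stab_fun p s) = p.2 * iota p.1 (val s) * p.2^-1.
Proof.
apply: preK; case: s => a /= /asboolP [->|[_ //]].
by rewrite gmulf1 mulg1 mulgV; apply: inH1.
Qed.

Fact stab_fun_morph p : monoid_morphism (@stab_fun p).
Proof.
split=> [|s t]; apply: jH_inj; rewrite ?gmulfM !stab_funE.
  by rewrite !gmulf1 mulg1 mulgV.
by rewrite !gmulfM !mulgA mulgVK.
Qed.
HB.instance Definition _ p := isUMagmaMorphism.Build _ H (@stab_fun p) (stab_fun_morph p).

(** Schreier generator: the quotient of two representatives of Hx, hence an element of H. It is 1
    exactly for the edges of the maximal tree. *)
Definition edge_elt i x := rho x * (tau i x * iota i (gam i x))^-1.

Lemma inH_edge i x : inH (edge_elt i x).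
Proof. exact: (cos_trans (cos_sym (tau_gam splitG jH i x)) (rhoP splitG jH x)). Qed.

Definition edge_fun p (m : subgroup_type (Subgroup (edge_closed p))) : H :=
  zpow (pre (edge_elt p.1 p.2)) (val m).

Fact edge_fun_morph p : monoid_morphism (@edge_fun p).
Proof. by split=> [|s t]; rewrite /edge_fun ?gmulf1 ?gmulfM //. Qed.
HB.instance Definition _ p := isUMagmaMorphism.Build _ H (@edge_fun p) (edge_fun_morph p).

Definition psi j : {hom KJ j -> H} :=
  match j with inl p => @stab_fun p | inr p => @edge_fun p end.

Local Notation L := (free_prod KJ).
Definition Psi : {hom L -> H} := fp_lift psi.

(** Here and in [in_edge_at], [insubd] falls back on 1 outside the subgroup. For edges this default
    matters: it makes tree edges trivial in [in_edge_tree]. *)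
Definition in_stab i x (a : K i) : L :=
  @fp_in _ KJ (inl (i, x)) (insubd 1 a).
Definition in_edge_at i x : L := @fp_in _ KJ (inr (i, x)) (insubd 1 Zone).
Definition in_edge i x : L := in_edge_at i (rho x).

Lemma in_stabM i x (a b : K i) : tau i x = x ->
  cos x (x * iota i a) -> cos x (x * iota i b) ->
  in_stab x (a * b) = in_stab x a * in_stab x b.
Proof.
move=> tx xa xb; rewrite /in_stab -gmulfM; congr fp_in.
apply: val_inj; rewrite valM !insubdK //; apply/asboolP; right => //.
split=> //; rewrite gmulfM mulgA; apply: cos_trans xb _; exact: cos_mul.
Qed.

Lemma in_stab1 i x : in_stab x (1 : K i) = 1.
Proof.
rewrite /in_stab; set s := insubd _ _; suff -> : s = 1 by rewrite gmulf1.
by apply: val_inj; rewrite /s insubdK //; apply/asboolP; left.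
Qed.

Lemma in_edge_cos i x y : cos x y -> in_edge i y = in_edge i x.
Proof. by rewrite /in_edge => /(rho_cos splitG) ->. Qed.

Lemma in_edge_tree i x : rho x = tau i x * iota i (gam i x) -> in_edge i x = 1.
Proof.
move=> E; rewrite /in_edge /in_edge_at; set s := insubd _ _.
suff -> : s = 1 by rewrite gmulf1.
apply: val_inj; rewrite /s val_insubd; case: ifP => // /asboolP[//|[_ []]].
have xr := rhoP splitG jH x.
by rewrite /= (tau_cos splitG _ xr) (gam_cos splitG _ xr) -E.
Qed.

Lemma edge_elt_cos i x y : cos x y -> edge_elt i y = edge_elt i x.
Proof.
move=> xy; rewrite /edge_elt (rho_cos splitG xy) (tau_cos splitG _ xy).
by rewrite (gam_cos splitG _ xy).
Qed.

Lemma Psi_in_edge i x : jH (Psi (in_edge i x)) = edge_elt i x.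
Proof.
have [E|E] := pselect (rho x = tau i x * iota i (gam i x)).
  by rewrite in_edge_tree // !gmulf1 /edge_elt E mulgV.
have xr := rhoP splitG jH x.
rewrite /Psi /= fp_lift_in /= /edge_fun insubdK; last first.
  apply/asboolP; right=> /=; split; first by rewrite (rho_cos splitG xr).
  by rewrite (tau_cos splitG _ xr) (gam_cos splitG _ xr).
by rewrite zpow1 preK /= (edge_elt_cos _ xr) //; apply: inH_edge.
Qed.

Lemma Psi_in_stab i x (a : K i) : tau i x = x -> cos x (x * iota i a) ->
  jH (Psi (in_stab x a)) = x * iota i a * x^-1.
Proof.
move=> tx xa; rewrite /Psi /= fp_lift_in /= stab_funE /= insubdK //.
by apply/asboolP; right.
Qed.

(** A loop at the base point of HxG_i: out to Hx, along [a], and back. By [cos_step] it lies in the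
    stabiliser of the coset of that base point. *)
Definition step i x (a : K i) := gam i x * a * (gam i (x * iota i a))^-1.

Lemma cos_step i x (a : K i) :
  cos (tau i x) (tau i x * iota i (step x a)).
Proof.
set y := x * iota i a; have t : tau i y = tau i x by apply/tau_dcos/dcos_mul.
have xg := tau_gam splitG jH i x; have yg := tau_gam splitG jH i y.
apply: (@cos_mulV _ _ (iota i (gam i y))); rewrite /step gmulfF gmulfM !mulgA mulgVK -/y.
rewrite -t in xg *; apply: cos_trans (cos_sym yg) _; exact: cos_mul.
Qed.

(* The inverse of [Psi] is found by extending, by the universal property of G, a
   cocycle defined on each factor to a morphism from G to the wreath product of
   the free product [L] with G; its image under
   [Psi] is [rho x * g * (rho (x * g))^-1]. *)
Definition local_cocycle i x (a : K i) : L :=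
  in_edge i x * in_stab (tau i x) (step x a) * (in_edge i (x * iota i a))^-1.

Definition wr_in i (a : K i) : wreath G L := (iota i a, fun x => local_cocycle x a).

Fact wr_in_morph i : monoid_morphism (@wr_in i).
Proof.
split=> [|a b]; apply: wr_eq => [|x] /=; rewrite ?gmulf1 ?gmulfM //.
  rewrite /local_cocycle /step gmulf1 mulg1 mulg1 mulgV in_stab1 mulg1 mulgV //.
rewrite /local_cocycle (tau_dcos splitG (dcos_mul iota jH x a)) !mulgA mulgVK.
rewrite -[in RHS](mulgA (in_edge i x)) -in_stabM ?tau_tau //; last 2 first.
- exact: cos_step.
- by have := cos_step (x * iota i a) b; rewrite (tau_dcos splitG (dcos_mul iota jH x a)).
by rewrite /step !mulgA mulgVK gmulfM !mulgA.
Qed.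
HB.instance Definition _ i :=
  isUMagmaMorphism.Build (K i) (wreath G L) (@wr_in i) (wr_in_morph i).

Definition wr_hom : {hom G -> wreath G L} := fp_ext splitG (fun i => @wr_in i).

Definition cocycle x g : L := (wr_hom g).2 x.

Lemma wr_hom1 g : (wr_hom g).1 = g.
Proof.
elim/(group_ind splitG): g => [|i a g IH]; first by rewrite gmulf1.
by rewrite gmulfM /= IH /= fp_extE.
Qed.

Lemma cocycleM x g h : cocycle x (g * h) = cocycle x g * cocycle (x * g) h.
Proof. by rewrite /cocycle gmulfM /= wr_hom1. Qed.

Lemma cocycle1 x : cocycle x 1 = 1.
Proof. by rewrite /cocycle gmulf1. Qed.

Lemma cocycle_in i x (a : K i) : cocycle x (iota i a) = local_cocycle x a.
Proof. by rewrite /cocycle /= fp_extE. Qed.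

Lemma local_cocycle_cos i x y (a : K i) : cos x y ->
  local_cocycle y a = local_cocycle x a.
Proof.
move=> xy; have xya := cos_mul (iota i a) xy.
rewrite /local_cocycle /step (tau_cos splitG _ xy) (gam_cos splitG _ xy).
by rewrite (gam_cos splitG _ xya) (in_edge_cos _ xy) (in_edge_cos _ xya).
Qed.

Lemma cocycle_cos x y g : cos x y -> cocycle y g = cocycle x g.
Proof.
elim/(group_ind splitG): g x y => [|i a g IH] x y xy; first by rewrite !cocycle1.
by rewrite !cocycleM !cocycle_in (local_cocycle_cos _ xy) (IH _ _ (cos_mul _ xy)).
Qed.

(** For one letter the edge and stabiliser contributions telescope; the cocycle rule then telescopes
    over the letters of g. *)
Lemma Psi_cocycle x g : jH (Psi (cocycle x g)) = rho x * g * (rho (x * g))^-1.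
Proof.
elim/(group_ind splitG): g x => [|i a g IH] x.
  by rewrite cocycle1 !gmulf1 !mulg1 mulgV.
rewrite cocycleM !gmulfM IH cocycle_in /local_cocycle !gmulfM !gmulfV !Psi_in_edge.
rewrite Psi_in_stab ?tau_tau //; last exact: cos_step.
rewrite /edge_elt (tau_dcos splitG (dcos_mul iota jH x a)) /step.
rewrite !gmulfM !gmulfV !(invgM, invgK, mulgA).
by rewrite !(mulgVK, mulgK).
Qed.

(** The path spelled by [rho x] stays in the maximal tree: its edges contribute 1, and at each base
    point the loop [step] is gam * gam^-1. *)
Lemma cocycle_rho x : cocycle 1 (rho x) = 1.
Proof.
have [m] := ubnP (clen splitG jH x); elim: m x => // m IH x xm.
have [x0|x0] := eqVneq (clen splitG jH x) 0%N.
  by rewrite rho_clen0 // cocycle1.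
have [i [E lt]] := rho_rec x0; rewrite E cocycleM mul1g cocycle_in.
rewrite {1}/tau IH ?mul1g; last exact: leq_trans lt _.
have xg := tau_gam splitG jH i x.
rewrite /local_cocycle /step (in_edge_cos _ xg) (in_edge_tree E).
rewrite gam_tau (gam_cos splitG _ xg) mul1g mulgV in_stab1 mulg1 invg1 mulg1.
by apply: in_edge_tree; rewrite rho_tau tau_tau gam_tau gmulf1 mulg1.
Qed.

Definition cocycle_H (h : H) : L := cocycle 1 (jH h).

(** The cocycle depends on its base point only through the coset, and an element of H does not move
    the coset H. *)
Fact cocycle_H_morph : monoid_morphism cocycle_H.
Proof.
split=> [|h k]; rewrite /cocycle_H ?gmulf1 ?cocycle1 // gmulfM cocycleM.
congr (_ * _); apply: cocycle_cos; rewrite mul1g /cos /= invg1 mulg1.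
by exists h.
Qed.
HB.instance Definition _ := isUMagmaMorphism.Build H L cocycle_H cocycle_H_morph.

Lemma cocycle_HK : cancel cocycle_H Psi.
Proof.
move=> h; apply: jH_inj; rewrite Psi_cocycle mul1g rho1 mul1g.
suff -> : rho (jH h) = 1 by rewrite invg1 mulg1.
by rewrite -(rho1 splitG jH); apply: rho_cos; exists h; rewrite invg1 mulg1.
Qed.

Lemma cocycle_conj x s : cocycle 1 x = 1 -> cos x (x * s) ->
  cocycle 1 (x * s * x^-1) = cocycle x s.
Proof.
move=> x1 xs; rewrite !cocycleM x1 !mul1g (cocycle_cos _ xs).
have : cocycle 1 (x * x^-1) = 1 by rewrite mulgV cocycle1.
by rewrite cocycleM x1 !mul1g => ->; rewrite mulg1.
Qed.

Lemma cocycle_stab i x (a : K i) : tau i x = x -> cos x (x * iota i a) ->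
  cocycle 1 (x * iota i a * x^-1) = in_stab x a.
Proof.
move=> tx xs; have x1 : cocycle 1 x = 1 by rewrite -tx cocycle_rho.
have gx : gam i x = 1 by rewrite -tx gam_tau.
have ex : in_edge i x = 1.
  by apply: in_edge_tree; rewrite tx gx gmulf1 mulg1 -{1}tx rho_tau.
rewrite cocycle_conj // cocycle_in /local_cocycle /step (in_edge_cos _ xs) ex.
by rewrite (gam_cos splitG _ xs) gx tx invg1 !mulg1 !mul1g invg1 mulg1.
Qed.

Lemma PsiK : cancel Psi cocycle_H.
Proof.
apply: (@fp_hom_eq _ KJ L (cocycle_H \o Psi) idfun) => j s /=.
rewrite /Psi /= fp_lift_in.
case: j s => -[i x] s /=.
  rewrite /cocycle_H stab_funE /=.
  have := valP s; rewrite /= /stab_pred /= => /asboolP[s1|[tx xs]].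
    have -> : s = 1 by apply: val_inj.
    by rewrite !gmulf1 mulg1 mulgV cocycle1.
  by rewrite cocycle_stab // /in_stab valKd.
rewrite /edge_fun gmulf_zpow /=.
have := valP s; rewrite /= /edge_pred /= => /asboolP[s1|[rx nt]].
  have -> : s = 1 by apply: val_inj.
  by rewrite !gmulf1.
set y := tau i x * iota i (gam i x) in nt.
have xy : cos x y := tau_gam splitG jH i x.
(* The tree path to [tau i x] contributes nothing; the last letter of [y] then crosses the edge
   once, backwards. *)
have cy : cocycle 1 y = (in_edge i x)^-1.
  rewrite cocycleM cocycle_rho !mul1g cocycle_in /local_cocycle /step.
  rewrite -/y tau_tau gam_tau (gam_cos splitG _ xy) mul1g mulgV in_stab1 mulg1.
  rewrite (in_edge_cos _ xy) [in_edge i (tau i x)]in_edge_tree ?mul1g //.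
  by rewrite rho_tau tau_tau gam_tau gmulf1 mulg1.
have -> : cocycle_H (pre (edge_elt i x)) = in_edge_at i x.
  rewrite /cocycle_H preK; last exact: inH_edge.
  rewrite /edge_elt -/y cocycleM cocycle_rho !mul1g rx -(cocycle_cos _ xy).
  apply: (@mulgI _ (cocycle 1 y)).
  have := cocycleM 1 y y^-1; rewrite mulgV cocycle1 mul1g => <-.
  by rewrite cy /in_edge rx mulVg.
rewrite /in_edge_at -gmulf_zpow; congr fp_in; apply: val_inj.
rewrite -[val _]/(sg_val _) gmulf_zpow -[RHS]zpow_Zone; congr (zpow _ _).
by apply: insubdK; apply/asboolP; right.
Qed.

Lemma kurosh_bijective : bijective Psi.
Proof. by exists cocycle_H; [exact: PsiK | exact: cocycle_HK]. Qed.

End Kurosh.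

(** * Indecomposable subgroups lie in conjugates of factors *)

Section SplitOneFactor.
Variables (J : choiceType) (K : J -> groupType) (H : groupType).
Variable psi : forall j, {hom K j -> H}.
Hypothesis splitH : is_free_product psi.
Variable j0 : J.

Definition other_factor (j : {j : J | j != j0}) := K (val j).

(** [freely_indecomposable] concerns decompositions indexed by [bool], so one factor is set against
    the free product of all others. *)
Definition split_factors (b : bool) : groupType :=
  if b then K j0 else free_prod other_factor.

Definition split_maps (b : bool) : {hom split_factors b -> H} :=
  match b with
  | true => psi j0
  | false => fp_lift (fun j : {j : J | j != j0} => psi (val j) : {hom other_factor j -> H})
  end.

Definition split_in_true : {hom split_factors true -> free_prod split_factors} :=
  @fp_in _ split_factors true.

Definition split_in_false : {hom free_prod other_factor -> free_prod split_factors} :=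
  (@fp_in _ split_factors false : {hom split_factors false -> free_prod split_factors}).

Definition split_in_neq (j : {j : J | j != j0}) :
  {hom other_factor j -> free_prod split_factors} :=
  split_in_false \o @fp_in _ other_factor j.

Definition split_in j : {hom K j -> free_prod split_factors} :=
  match pselect (j = j0) with
  | left e =>
      ecast k {hom K k -> free_prod split_factors} (esym e)
        (split_in_true : {hom K j0 -> free_prod split_factors})
  | right ne =>
      (split_in_neq (exist _ j (introN eqP ne)) : {hom K j -> free_prod split_factors})
  end.

Lemma split_in0 a : split_in j0 a = @fp_in _ split_factors true a.
Proof. by rewrite /split_in; case: pselect => // e; rewrite eq_axiomK. Qed.

Lemma split_in_other (j : {j : J | j != j0}) (a : other_factor j) :
  split_in (val j) a = @fp_in _ split_factors false (@fp_in _ other_factor j a).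
Proof.
case: j a => j ne a; rewrite /split_in; case: pselect => [e|ne'].
  by have /eqP := ne; case.
by rewrite /= (bool_irrelevance (introN eqP ne') ne).
Qed.

Lemma split_free_product : is_free_product split_maps.
Proof.
exists (fp_ext splitH split_in).
  apply: (@fp_hom_eq _ split_factors _
    (fp_ext splitH split_in \o fp_lift split_maps) idfun).
  case=> a /=; rewrite fp_lift_in; first by rewrite /= fp_extE split_in0.
  suff E : fp_ext splitH split_in \o split_maps false =1 split_in_false by exact: E.
  apply: (@fp_hom_eq _ other_factor _
    (fp_ext splitH split_in \o (split_maps false : {hom free_prod other_factor -> H}))
    split_in_false) => j b /=.
  by rewrite fp_lift_in fp_extE split_in_other.
apply: (@hom_eq_on_factors _ _ _ _ splitH _
  (fp_lift split_maps \o fp_ext splitH split_in) idfun).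
move=> j a /=; rewrite fp_extE; have [e|ne] := eqVneq j j0.
  by case: j / {e}(esym e) a => a; rewrite split_in0 fp_lift_in.
by rewrite (@split_in_other (exist _ j ne) a) fp_lift_in /= fp_lift_in.
Qed.

End SplitOneFactor.

(** Some factor is non-trivial because H is; indecomposability then makes the free product of the
    others trivial. *)
Lemma indecomposable_factor (J : choiceType) (K : J -> groupType) (H : groupType)
    (psi : forall j, {hom K j -> H}) :
  is_free_product psi -> freely_indecomposable H -> ~ trivial_group H ->
  exists j, forall h, exists k, h = psi j k.
Proof.
move=> splitH indH ntH.
have [j0 ntj] : exists j, ~ trivial_group (K j).
  apply: contra_notP ntH => /forallNP tr h.
  elim/(group_ind splitH): h => // j a h ->.
  by rewrite (contrapT (tr j) a) gmulf1 mulg1.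
exists j0; have := indH _ _ (split_free_product splitH j0).
case=> b; case: b => [//|tr].
move=> h; elim/(group_ind splitH): h => [|j a h [k ->]].
  by exists 1; rewrite gmulf1.
have [e|ne] := eqVneq j j0.
  by case: j / {e}(esym e) a => a; exists (a * k); rewrite gmulfM.
exists k; suff -> : psi j a = 1 by rewrite mul1g.
pose x : split_factors K j0 false := @fp_in _ (@other_factor _ K j0) (exist _ j ne) a.
have <- : split_maps psi j0 false x = psi j a by rewrite /= fp_lift_in.
by rewrite (tr x) gmulf1.
Qed.

Section KuroshIndecomposable.
Variables (I : choiceType) (K : I -> groupType) (G : groupType).
Variable iota : forall i, {hom K i -> G}.
Hypothesis splitG : is_free_product iota.
Import ssrint.

(** By the Kurosh decomposition H is a single factor. A vertex stabiliser lies in a conjugate of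
    some [K i]; an edge factor is trivial or infinite cyclic, and both are excluded. *)
Lemma indecomposable_in_conjugate (H : groupType) (jH : {hom H -> G}) :
  injective jH -> freely_indecomposable H -> ~ infinite_cyclic H ->
  ~ trivial_group H ->
  exists i x, forall h, exists a, jH h = x * iota i a * x^-1.
Proof.
move=> jI indH nZ ntH.
have [[[i x]|[i x]] psiS] :=
    indecomposable_factor (kurosh_bijective splitG jI) indH ntH.
  by exists i, x => h; have [k ->] := psiS h; exists (val k); rewrite /= stab_funE.
case: nZ; set e := pre jH (edge_elt splitG jH i x) in psiS.
have hE h : exists m : Zgroup, h = zpow e m /\ (edge_pred splitG jH (i, x) m).
  by have [k ->] := psiS h; exists (val k); split=> //; apply: valP.
have [m0 [m01 Em0]] : exists m : Zgroup, m <> 1 /\ edge_pred splitG jH (i, x) m.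
  apply: contrapT => /forallNP nm; apply: ntH => h; have [m [-> Em]] := hE h.
  have [->|m1] := pselect (m = 1); first exact: gmulf1.
  by case: (nm m).
(* [edge_pred] is all or nothing: one non-trivial member puts every integer in it. *)
have E m : edge_pred splitG jH (i, x) m.
  by apply/asboolP; right; case/asboolP: Em0.
have eI : injective (zpow e).
  pose k m : KJ splitG jH (inr (i, x)) :=
    @SubgroupElt _ (Subgroup (edge_closed splitG jH (i, x))) m (E m).
  move=> m n mn.
  have := @is_free_product_inj _ _ _ _ (kurosh_bijective splitG jI) (inr (i, x)).
  by move=> /(_ (k m) (k n) mn) [].
split; last first.
  exists e => h; have [m [-> _]] := hE h.
  by case: m => k; [exists k; left | exists k.+1; right].
move=> fin; apply: infinite_nat.
have nI : injective (fun k : nat => zpow e (Posz k)) by move=> k l /eI [].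
rewrite -(preimage_setT (fun k : nat => zpow e (Posz k))).
by apply: finite_preimage fin => k l _ _; apply: nI.
Qed.

End KuroshIndecomposable.

(** * Distances in the Bass-Serre tree *)

Section CosetLengths.
Variables (I : choiceType) (K : I -> groupType) (G : groupType).
Variable iota : forall i, {hom K i -> G}.
Hypothesis splitG : is_free_product iota.
Implicit Types (i j k : I) (g u v w x y : G).
Local Notation len := (len splitG).
Local Notation minr := (minr splitG).
Local Notation minl := (minl splitG).
Local Notation gnf := (gnf splitG).

(* With the base point at 1, [rlen i w] and [dlen i j (u^-1 * w)] measure the
   distance in the Bass-Serre tree from the base point to the coset w G_i, and
   between the cosets u G_i and w G_j. *)
Definition rlen i w := len (w * iota i (sval (cid (ex_minr splitG i w)))).

Definition dlen i j w :=
  let a := cid (ex_min2 splitG i j w) in let b := cid (svalP a) in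
  len (iota i (sval a) * w * iota j (sval b)).

Lemma rlenP i w : exists a : K i, minr i (w * iota i a) /\ len (w * iota i a) = rlen i w.
Proof. by rewrite /rlen; case: cid => a; exists a. Qed.

Lemma rlen_le i w (a : K i) : (rlen i w <= len (w * iota i a))%N.
Proof.
have [b [m <-]] := rlenP i w; have := m (b^-1 * a).
by rewrite gmulfM gmulfV !mulgA mulgK.
Qed.

Lemma rlen_le1 i w : (rlen i w <= len w)%N.
Proof. by have := rlen_le w (1 : K i); rewrite gmulf1 mulg1. Qed.

Lemma rlen_mul i w (a : K i) : rlen i (w * iota i a) = rlen i w.
Proof.
apply/eqP; rewrite eqn_leq; apply/andP; split.
  have [b [_ <-]] := rlenP i w; have := rlen_le (w * iota i a) (a^-1 * b).
  by rewrite gmulfM gmulfV !mulgA mulgK.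
have [b [_ <-]] := rlenP i (w * iota i a).
by rewrite -mulgA -(iotaM iota) rlen_le.
Qed.

Lemma rlen_min i w : minr i w -> rlen i w = len w.
Proof.
move=> m; apply/eqP; rewrite eqn_leq rlen_le1 /=.
have [b [_ <-]] := rlenP i w; exact: m.
Qed.

Lemma dlenP i j w : exists (a : K i) (b : K j),
  [/\ minl i (iota i a * w * iota j b), minr j (iota i a * w * iota j b)
    & len (iota i a * w * iota j b) = dlen i j w].
Proof.
rewrite /dlen; case: cid => a /= Ea; case: cid => b /= m; exists a, b; split=> // c.
  by rewrite !mulgA -(iotaM iota) m.
by rewrite -[_ * iota j c]mulgA -(iotaM iota) m.
Qed.

Lemma dlen_le i j w (a : K i) (b : K j) : (dlen i j w <= len (iota i a * w * iota j b))%N.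
Proof. by rewrite /dlen; case: cid => c /= Ec; case: cid => d /= m. Qed.

Lemma dlen_mul i j w (a : K i) (b : K j) :
  dlen i j (iota i a * w * iota j b) = dlen i j w.
Proof.
apply/eqP; rewrite eqn_leq; apply/andP; split.
  have [c [d [_ _ <-]]] := dlenP i j w.
  have := dlen_le (iota i a * w * iota j b) (c * a^-1) (b^-1 * d).
  by rewrite !gmulfM !gmulfV !mulgA mulgVK mulgK.
have [c [d [_ _ <-]]] := dlenP i j (iota i a * w * iota j b).
have := dlen_le w (c * a) (b * d); by rewrite !gmulfM !mulgA.
Qed.

Lemma dlen_mull i j w (a : K i) : dlen i j (iota i a * w) = dlen i j w.
Proof. by rewrite -(dlen_mul w a (1 : K j)) gmulf1 mulg1. Qed.

(** The extra 1 pays for the letter of the factor i that may be spent on turning at the intermediate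
    vertex. *)
Lemma rlen_triangle i j u y : (rlen j (u * y) <= (rlen i u + dlen i j y).+1)%N.
Proof.
have [a [_ <-]] := rlenP i u; have [b [c [_ _ <-]]] := dlenP i j y.
have := rlen_le (u * y) c.
have -> : u * y * iota j c
    = (u * iota i a) * (iota i (a^-1 * b^-1) * (iota i b * y * iota j c)).
  by rewrite !gmulfM !gmulfV !mulgA mulgK mulgVK.
move=> le; apply: (leq_trans le); apply: leq_trans (lenM _ _ _) _.
rewrite -addnS leq_add2l; apply: leq_trans (lenM _ _ _) _.
by rewrite -add1n leq_add2r len_in.
Qed.

Lemma dlen_triangle i k j x y :
  (dlen i j (x * y) <= (dlen i k x + dlen k j y).+1)%N.
Proof.
have [a [e [_ _ <-]]] := dlenP i k x; have [b [c [_ _ <-]]] := dlenP k j y.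
have := dlen_le (x * y) a c.
have -> : iota i a * (x * y) * iota j c
    = (iota i a * x * iota k e) * (iota k (e^-1 * b^-1) * (iota k b * y * iota j c)).
  by rewrite !gmulfM !gmulfV !mulgA mulgK mulgVK.
move=> le; apply: (leq_trans le); apply: leq_trans (lenM _ _ _) _.
rewrite -addnS leq_add2l; apply: leq_trans (lenM _ _ _) _.
by rewrite -add1n leq_add2r len_in.
Qed.

(* Rotating a coset about u G_i brings it on the base point side of u G_i for
   exactly one rotation; for all others the geodesic passes through u G_i. *)
Lemma rlen_rotate i j u y : i != j -> exists a0 : K i,
  (rlen j (u * iota i a0 * y) <= rlen i u + dlen i j y)%N /\
  forall a, a != a0 -> rlen j (u * iota i a * y) = (rlen i u + dlen i j y).+1.
Proof.
move=> ij; have [a [mu <-]] := rlenP i u; have [b [c [ml mr <-]]] := dlenP i j y.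
set u' := u * _ in mu *; set y' := _ * _ * _ in ml mr *.
have E e : u * iota i e * y = u' * iota i (a^-1 * e * b^-1) * y' * iota j c^-1.
  by rewrite /u' /y' !gmulfM !gmulfV !mulgA !mulgK mulgVK.
exists (a * b); split.
  rewrite E mulKg mulgV gmulf1 mulg1 rlen_mul.
  exact: leq_trans (rlen_le1 _ _) (lenM _ _ _).
move=> e eab; rewrite E rlen_mul.
have ne1 : a^-1 * e * b^-1 != 1.
  apply: contra_neq eab => E1; rewrite -[e](mulVKg a).
  by rewrite -[a^-1 * e](mulgVK b) E1 mul1g.
have ij' : (i != j) || (y' != 1) by rewrite ij.
have [_ m] := gnf_concat mu ml mr ij' ne1.
by rewrite (rlen_min m) (len_concat mu ml mr ij' ne1).
Qed.

(** Equality in the triangle inequality means that the geodesic to w G_j passes through u G_i; on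
    normal forms this becomes a prefix relation, with a letter of the factor i next. *)
Lemma rlen_through i j u w : i != j ->
  rlen j w = (rlen i u + dlen i j (u^-1 * w)).+1 ->
  exists (a b : K i) (c : K j) (y : fp_word K),
  [/\ minr j (w * iota j c), minr i (u * iota i b)
    & gnf (w * iota j c) = gnf (u * iota i b) ++ Tagged K a :: y].
Proof.
move=> ij E; have [b [mu El]] := rlenP i u.
have [e [c [ml mr Ed]]] := dlenP i j (u^-1 * w).
set u' := u * _ in mu El; set y' := _ * _ * _ in ml mr Ed.
have Ew : w * iota j c = u' * iota i (b^-1 * e^-1) * y'.
  by rewrite /u' /y' !gmulfM !gmulfV !mulgA !mulgK mulgVK mulgV mul1g.
have ne1 : b^-1 * e^-1 != 1.
  (* Without a turning letter the length would be at most [rlen i u] plus the distance, one less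
     than assumed. *)
  apply/eqP => E1; have := rlen_mul w c; rewrite Ew E1 gmulf1 mulg1 E.
  move=> Er; have := leq_trans (rlen_le1 j (u' * y')) (lenM splitG u' y').
  by rewrite Er -Ed -El ltnn.
have ij' : (i != j) || (y' != 1) by rewrite ij.
have [Eg m] := gnf_concat mu ml mr ij' ne1.
by exists (b^-1 * e^-1), b, c, (gnf y'); rewrite Ew.
Qed.

Lemma cat_cons_prefix (T : Type) (u v y z : seq T) (s t : T) :
  u ++ s :: y = v ++ t :: z -> (size u < size v)%N -> exists q : seq T, v = u ++ s :: q.
Proof.
elim: u v => [|a u IH] [|b v] //=; first by case=> -> _ _; exists v.
by case=> -> /IH H; rewrite ltnS => /H [q ->]; exists q.
Qed.

(** Converse to [rlen_through]: the letters after the prefix and [a] spell a path from u G_i to v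
    G_k. *)
Lemma prefix_dlen i k u v (a b : K i) (d : K k) z : minr k (v * iota k d) ->
  minr i (u * iota i b) ->
  gnf (v * iota k d) = gnf (u * iota i b) ++ Tagged K a :: z ->
  ((rlen i u + dlen i k (u^-1 * v)).+1 <= rlen k v)%N.
Proof.
move=> mv mu E; rewrite -(rlen_mul v d) -(rlen_mul u b) (rlen_min mv) (rlen_min mu).
rewrite -[len (v * iota k d)]/(size (gnf (v * iota k d))) E size_cat /=.
rewrite -addnS leq_add2l ltnS.
apply: leq_trans (len_eval splitG z).
suff <- : iota i (a^-1 * b^-1) * (u^-1 * v) * iota k d = fp_eval iota z by exact: dlen_le.
have {}E : v * iota k d = u * iota i b * iota i a * fp_eval iota z.
  by rewrite -(gnfK splitG (v * _)) E eval_cat eval_cons gnfK mulgA.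
rewrite -!mulgA E !gmulfM !gmulfV !mulgA !(mulgVK, mulgK) //.
by rewrite mulVg mul1g.
Qed.

(* If u G_i and v G_k lie on the geodesic from the base point to w G_j, then one
   of them lies on the geodesic to the other. *)
Lemma rlen_nested i j k u v w : i != j -> k != j -> i != k ->
  rlen j w = (rlen i u + dlen i j (u^-1 * w)).+1 ->
  rlen j w = (rlen k v + dlen k j (v^-1 * w)).+1 ->
  ((rlen i u + dlen i k (u^-1 * v)).+1 <= rlen k v)%N \/
  ((rlen k v + dlen k i (v^-1 * u)).+1 <= rlen i u)%N.
Proof.
move=> ij kj ik /(rlen_through ij) [a [b [c [y [mw mu Eu]]]]].
move=> /(rlen_through kj) [a' [b' [c' [y' [mw' mv Ev]]]]].
(* The shortest element of w G_j is unique, so both prefixes are prefixes of one word and can be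
   compared by size. *)
have cc : c' = c.
  have := mw'; rewrite -{1}(mulVKg c c') gmulfM mulgA => /(minr_unique mw) E1.
  by rewrite -[c'](mulVKg c) E1 mulg1.
rewrite cc Eu in Ev.
case: (ltngtP (size (gnf (u * iota i b))) (size (gnf (v * iota k b')))).
- by move=> lt; have [z Ez] := cat_cons_prefix Ev lt; left; apply: prefix_dlen mv mu Ez.
- move=> lt; have [z Ez] := cat_cons_prefix (esym Ev) lt.
  by right; apply: prefix_dlen mu mv Ez.
(* Prefixes of equal size would be followed by the same letter, lying in both factors i and k. *)
move=> sz; have := congr1 (drop (size (gnf (u * iota i b)))) Ev.
rewrite drop_size_cat // sz drop_size_cat // => /(congr1 (starts k)) /= eik.
by rewrite eqxx (negPf ik) in eik.
Qed.

End CosetLengths.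

(** * Systems of vertices, none of which separates another from the base point *)

Section IrreducibleFrames.
Variables (I : choiceType) (K : I -> groupType) (G : groupType).
Variable iota : forall i, {hom K i -> G}.
Hypothesis splitG : is_free_product iota.
Implicit Types (i j k : I) (g h : G) (p w : fp_word K).
Local Notation gnf := (gnf splitG).

Lemma starts_neq i j w : starts i w -> i != j -> ~~ starts j w.
Proof. by case: w => //= t w /eqP-> ->. Qed.

(** Letters of p cancel against g as long as the two words agree. At the first disagreement a letter
    in the factor of the current letter of p remains in front, and the rest of p can no longer
    cancel. *)
Lemma strip_starts j p g : reduced p -> ~~ ends j p ->
  (forall (b : K j) z, gnf g <> p ++ Tagged K b :: z) ->
  ~~ starts j (gnf ((fp_eval iota p)^-1 * g)).
Proof.
elim: p g => [|[i c] p IH] g.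
  by move=> _ _ np; rewrite eval_nil invg1 mul1g; apply/negP => /startsP[b [z /np]].
move=> rp np nopre; have /and3P[c1 sp rp'] := rp.
rewrite -[existT _ _ _]/(Tagged K c) eval_cons invgM -mulgA -gmulfV.
set h := iota i c^-1 * g; have hE : gnf h = mulw c^-1 (gnf g) := gnf_mul splitG _ _.
have rg := gnf_reduced splitG g.
have heads : starts i (gnf h) -> ~~ starts j (gnf ((fp_eval iota p)^-1 * h)).
  move=> si; case: p {IH nopre hE} rp' sp np {rp} (IH h) => [|t p] rp' sp np IH.
    rewrite eval_nil invg1 mul1g; apply: starts_neq si _.
    by move: np; rewrite /ends /=.
  apply: IH => //; first by rewrite ends_cons in np.
  by move=> b z E; move: si sp; rewrite E /= => /eqP->; rewrite eqxx.
have c1' : c^-1 != 1 by rewrite invg_eq1.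
case: (boolP (starts i (gnf g))) => [/startsP[d [W EW]]|ns]; last first.
  by apply: heads; rewrite hE mulw_cons //= eqxx.
have /and3P[d1 _ rW] : reduced (Tagged K d :: W) by rewrite -EW.
rewrite EW mulw_merge // in hE; case: eqP hE => [cd|_] hE; last first.
  by apply: heads; rewrite hE /= eqxx.
apply: IH => //.
  by case: p np {rp nopre heads rp' sp} => [//|t p]; rewrite ends_cons.
move=> b z E; apply: (nopre b z); rewrite EW -hE E /=.
by congr (existT _ _ _ :: _); apply: (@mulgI _ c^-1); rewrite cd mulVg.
Qed.

Variable u : I -> G.
Hypothesis u_min : forall i, minr splitG i (u i).
Hypothesis u_irr : forall i j (a : K i) z, i != j ->
  gnf (u j) <> gnf (u i) ++ Tagged K a :: z.

Definition conj_in i : {hom K i -> G} := conj_left (u i) \o iota i.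

Lemma conj_prefix j (x : K j) h : x != 1 ->
  (forall (b : K j) z, gnf h <> gnf (u j) ++ Tagged K b :: z) ->
  exists z, gnf (conj_in j x * h) = gnf (u j) ++ Tagged K x :: z.
Proof.
move=> x1 np; exists (gnf ((u j)^-1 * h)).
have nej := minr_ends (@u_min j).
have := strip_starts (gnf_reduced splitG (u j)) nej np; rewrite gnfK => sy.
rewrite -[RHS](reduced_gnf splitG).
  by rewrite eval_cat eval_cons !gnfK !mulgA.
by rewrite reduced_cat_cons gnf_reduced /= x1 sy gnf_reduced nej.
Qed.

(** A ping-pong argument: the product of the later letters begins with [gnf (u k)] and a letter of
    the factor k, where k differs from j. By [u_irr] it cannot begin with [gnf (u j)] and a letter
    of the factor j, so the next conjugation does not destroy the prefix. *)
Lemma conj_word_prefix j (x : K j) w : reduced (Tagged K x :: w) ->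
  exists z, gnf (fp_eval conj_in (Tagged K x :: w)) = gnf (u j) ++ Tagged K x :: z.
Proof.
elim: w j x => [|[k x'] w IH] j x rw; have /and3P[x1 _ _] := rw.
  rewrite eval_cons eval_nil; apply: conj_prefix => // b z.
  by rewrite gnf1; case: (gnf (u j)).
have /and3P[_ /= kj rw'] := rw.
have [q Eq] := IH k x' rw'; rewrite eval_cons; apply: conj_prefix => // b z.
rewrite Eq => E.
case: (ltngtP (size (gnf (u k))) (size (gnf (u j)))).
- by move/(cat_cons_prefix E) => [r Er]; apply: (u_irr kj Er).
- move/(cat_cons_prefix (esym E)) => [r Er]; rewrite eq_sym in kj.
  exact: (u_irr kj Er).
move=> sz; have := congr1 (drop (size (gnf (u k)))) E.
rewrite drop_size_cat // sz drop_size_cat // => /(congr1 (starts k)) /=.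
by rewrite eqxx eq_sym (negPf kj).
Qed.

(** A non-trivial element of [K k] has a normal form of one letter. Written in the conjugated
    factors, it begins with [gnf (u j)] and one more letter, which forces [u j = 1] and j = k. *)
Lemma irreducible_frame : (forall i, ~ trivial_group (K i)) ->
  (forall g, exists w, fp_eval conj_in w = g) -> forall k, u k = 1.
Proof.
move=> ntK surj k.
have [a a1] : exists a : K k, a != 1.
  apply: contrapT => /forallNP H; apply: (ntK k) => a.
  by apply: contrapT => /eqP/H.
have [w Ew] := surj (iota k a).
rewrite -(fp_eval_eq conj_in (nf_fp_eq w)) in Ew.
have ga : gnf (iota k a) = [:: Tagged K a].
  rewrite -[iota k a]mulg1 -(eval_nil iota) -eval_cons reduced_gnf //.
  by rewrite /= a1.
have := nf_reduced w; case: (nf w) Ew => [|[j x] v] Ew rv.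
  by have := gnf1 splitG; rewrite -(eval_nil conj_in) Ew ga.
have [z] := conj_word_prefix rv; rewrite Ew ga.
case E: (gnf (u j)) => [|t r] /=; last by case: r {E}.
move/(congr1 (starts k)); rewrite /= eqxx => /esym/eqP <-.
by rewrite -(gnfK splitG (u j)) E eval_nil.
Qed.

End IrreducibleFrames.

(** * Automorphisms as configurations of vertices *)

Section PartialConjugationRelations.
Variables (n : nat) (G : groupType) (G_ : 'I_n -> groupType).
Variable iota : forall i, {hom G_ i -> G}.
Hypothesis splitG : is_free_product iota.
Implicit Types (i j k l : 'I_n).
Local Notation pconj := (pconj splitG).
Local Notation factor_aut := (factor_aut splitG).

Lemma aut_eq_on_factors (a b : Aut G) :
  (forall k x, a (iota k x) = b (iota k x)) -> a = b.
Proof. by move=> E; apply: autP; apply: (hom_eq_on_factors splitG). Qed.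

Lemma autM_E (a b : Aut G) x : (a * b) x = b (a x). Proof. by []. Qed.

Lemma autV_E (a : Aut G) x : a x^-1 = (a x)^-1.
Proof. exact: gmulfV. Qed.

Lemma pconj_eq i j (hij : i != j) g x :
  pconj hij g (iota j x) = iota i g * iota j x * (iota i g)^-1.
Proof. exact: pconj_fun_eq. Qed.

Lemma pconj_neq i j (hij : i != j) g k x : k != j ->
  pconj hij g (iota k x) = iota k x.
Proof. exact: pconj_fun_neq. Qed.

Lemma factor_autE phi k x : factor_aut phi (iota k x) = iota k (phi k x).
Proof. exact: factor_funE. Qed.

Lemma pconj_commute1 i j k (hij : i != j) (hik : i != k) g h : j != k ->
  commute (pconj hij g) (pconj hik h).
Proof.
move=> jk; apply: aut_eq_on_factors => l x; rewrite !autM_E.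
have kj : k != j by rewrite eq_sym.
have [e|lj] := eqVneq l j.
  case: l / {e}(esym e) x => x.
  by rewrite pconj_eq (pconj_neq hik _ _ jk) pconj_eq !aut_morph autV_E !pconj_neq.
have [e|lk] := eqVneq l k; last by rewrite !pconj_neq.
case: l / {e lj}(esym e) x => x.
by rewrite pconj_neq // pconj_eq !aut_morph autV_E !pconj_neq.
Qed.

Lemma pconj_commute2 i j k l (hij : i != j) (hkl : k != l) g h :
  uniq [:: i; j; k; l] -> commute (pconj hij g) (pconj hkl h).
Proof.
rewrite /= !inE !negb_or -!andbA => /and4P[_ ik il /and4P[jk jl _ _]].
have kj : k != j by rewrite eq_sym.
have li : l != i by rewrite eq_sym.
apply: aut_eq_on_factors => m x; rewrite !autM_E.
have [e|mj] := eqVneq m j.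
  case: m / {e}(esym e) x => x.
  by rewrite pconj_eq (pconj_neq hkl _ _ jl) pconj_eq !aut_morph autV_E !pconj_neq.
have [e|ml] := eqVneq m l; last by rewrite !pconj_neq.
have lj : l != j by rewrite eq_sym.
case: m / {e mj}(esym e) x => x.
by rewrite (pconj_neq hij _ _ lj) pconj_eq !aut_morph autV_E !pconj_neq.
Qed.

Lemma pconj_commute3 i j k (hjk : j != k) (hij : i != j) (hik : i != k) g h :
  commute (pconj hjk g) (pconj hij h * pconj hik h).
Proof.
apply: aut_eq_on_factors => m x; rewrite !autM_E.
have [e|mj] := eqVneq m j.
  case: m / {e}(esym e) x => x.
  rewrite (pconj_neq hjk) // pconj_eq !aut_morph !autV_E.
  by rewrite !(pconj_neq hik) // !(pconj_neq hjk).
have [e|mk] := eqVneq m k; last by rewrite !pconj_neq.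
have kj : k != j by rewrite eq_sym.
case: m / {e mj}(esym e) x => x.
rewrite (pconj_eq hjk) (pconj_neq hij _ _ kj) (pconj_eq hik) !aut_morph !autV_E.
rewrite !(pconj_neq hij _ _ kj) !(pconj_eq hij) !aut_morph !autV_E.
rewrite !(pconj_neq hik _ _ hik) !(pconj_neq hik _ _ hjk) (pconj_eq hik).
rewrite !(pconj_neq hjk _ _ hik) (pconj_eq hjk).
by rewrite !(invgM, invgK) !mulgA !mulgVK.
Qed.

Lemma factor_pconj i j (hij : i != j) g phi :
  pconj hij g * factor_aut phi = factor_aut phi * pconj hij (phi i g).
Proof.
apply: aut_eq_on_factors => m x; rewrite !autM_E factor_autE.
have [e|mj] := eqVneq m j; last by rewrite !pconj_neq // factor_autE.
case: m / {e}(esym e) x => x.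
by rewrite !pconj_eq !aut_morph !autV_E !factor_autE.
Qed.

Lemma factor_aut_inj : injective factor_aut.
Proof.
move=> phi psi E; apply: functional_extensionality_dep => i; apply: autP => x.
by apply: (is_free_product_inj splitG); rewrite -!factor_autE E.
Qed.

Lemma prod_pconj i (v : seq {j : 'I_n | i != j}) g j (x : G_ j) : uniq v ->
  (\prod_(t <- v) pconj (valP t) g) (iota j x) =
  if j \in [seq val t | t <- v] then iota i g * iota j x * (iota i g)^-1
  else iota j x.
Proof.
elim: v j x => [|t v IH] j x; first by rewrite big_nil.
rewrite cons_uniq => /andP[nv uv]; rewrite big_cons autM_E map_cons inE.
have [e|jt] := eqVneq j (val t); last by rewrite pconj_neq // IH.
case: j / {e}(esym e) x => x.
rewrite pconj_eq !aut_morph !autV_E !IH // mem_map ?(negPf nv); last exact: val_inj.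
rewrite [i \in _](_ : _ = false) //.
by apply/negbTE/mapP => -[l _ E]; have := valP l; rewrite /= -E eqxx.
Qed.

(** The product conjugates all other factors by g on the left; [inn], which is x -> g^-1 x g, undoes
    this and leaves its mark on G_i only. This is relation 4 in [Aut G]. *)
Lemma inn_factor i (v : seq {j : 'I_n | i != j}) g :
  uniq v -> (forall t, t \in v) ->
  (\prod_(t <- v) pconj (valP t) g) * inn (iota i g) = factor_aut (Ad g).
Proof.
move=> uv vT; apply: aut_eq_on_factors => j x.
rewrite autM_E prod_pconj // factor_autE /Ad innE.
have [e|ij] := eqVneq i j.
  case: j / e x => x; rewrite dfwith_in innE !gmulfM gmulfV.
  by case: ifP => // /mapP[[l hil] _ /= E]; rewrite -E eqxx in hil.
rewrite dfwith_out // ifT; first by rewrite !mulgA mulVg mul1g mulgVK.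
by apply/mapP; exists (exist _ j ij).
Qed.

End PartialConjugationRelations.

(** * Distances between the vertices of an automorphism *)

Section VertexDistances.
Variables (n : nat) (G : groupType) (G_ : 'I_n -> groupType).
Variable iota : forall i, {hom G_ i -> G}.
Hypothesis splitG : is_free_product iota.
Hypothesis ntG : forall i, ~ trivial_group (G_ i).
Implicit Types (i j k l : 'I_n) (a b : Aut G) (u v w : G).
Local Notation pconj := (pconj splitG).
Local Notation rlen := (rlen splitG).
Local Notation dlen := (dlen splitG).

(** Only an inclusion of a(G_i) in the conjugate is demanded; equality follows in [is_cj_onto]. The
    vertex v_i of the automorphism is w G_i, well defined by malnormality. *)
Definition is_cj a i w := forall x : G_ i, exists y : G_ i,
  a (iota i x) = w * iota i y * w^-1.

Hypothesis cjE : forall a i, exists w, is_cj a i w.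

Lemma ex_nt i : exists x : G_ i, x != 1.
Proof.
apply: contrapT => /forallNP H; apply: (ntG (i := i)) => x.
by apply: contrapT => /eqP/H.
Qed.

Lemma is_cj_unique a i v w : is_cj a i v -> is_cj a i w -> exists c, w = v * iota i c.
Proof.
move=> av aw; have [x x1] := ex_nt i; have [y Ey] := av x; have [z Ez] := aw x.
have z1 : z != 1.
  apply: contra_neq x1 => z1; move: Ez; rewrite z1 gmulf1 mulg1 mulgV.
  move=> E; apply: (is_free_product_inj splitG); rewrite gmulf1.
  by apply: (bij_inj (aut_bij a)); rewrite E gmulf1.
have E : (w^-1 * v)^-1 * iota i z * (w^-1 * v) = iota i y.
  rewrite invgM invgK; apply: (@mulIg _ v^-1); apply: (@mulgI _ v).
  by rewrite !mulgA mulgV mul1g mulgK -Ez Ey.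
have [c Ec] := factor_malnormal splitG z1 E; exists c^-1.
by rewrite gmulfV -Ec invgM invgK mulVKg.
Qed.

(** The inverse of a also sends G_i into a conjugate. Composing both inclusions, malnormality places
    the total conjugator in G_i, so preimages can be read off. *)
Lemma is_cj_onto a i w : is_cj a i w ->
  forall y, exists x, a (iota i x) = w * iota i y * w^-1.
Proof.
move=> aw y; have [v bv] := cjE a^-1 i.
have aV x : a (a^-1 x) = x by exact: aut_inv_funK.
have Va x : a^-1 (a x) = x by exact: aut_funK.
have [z z1] := ex_nt i; have [c Ec] : exists c, (a v * w)^-1 = iota i c.
  have [z' Ez'] := bv z; have [t Et] := aw z'.
  have Ez : a v * w * iota i t * (a v * w)^-1 = iota i z.
    by rewrite -[RHS]aV Ez' !aut_morph autV_E Et invgM !mulgA.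
  apply: (@factor_malnormal _ _ _ _ splitG i _ t z) => //; last by rewrite invgK.
  apply: contra_neq z1 => t1; move: Ez; rewrite t1 gmulf1 mulg1 mulgV => E.
  by apply: (is_free_product_inj splitG); rewrite gmulf1.
have [x Ex] := bv (c^-1 * y * c); exists x.
have := congr1 a Ex; rewrite aV !aut_morph autV_E => E.
have -> : a (iota i x) = (a v)^-1 * iota i (c^-1 * y * c) * a v.
  by rewrite E !mulgA mulVg mul1g mulgVK.
rewrite !(iotaM iota) gmulfV -Ec invgK invgM !mulgA mulVg mul1g.
by rewrite mulgVK.
Qed.

Definition cj a i := sval (cid (cjE a i)).
Lemma cjP a i : is_cj a i (cj a i). Proof. exact: svalP (cid (cjE a i)). Qed.
Arguments cjP : clear implicits.

Definition dist a i := rlen i (cj a i).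
Definition dist2 a i j := dlen i j ((cj a i)^-1 * cj a j).

Lemma dist_cj a i w : is_cj a i w -> dist a i = rlen i w.
Proof. by move=> aw; have [c ->] := is_cj_unique (cjP a i) aw; rewrite rlen_mul. Qed.

Lemma dist2_cj a i j v w : is_cj a i v -> is_cj a j w ->
  dist2 a i j = dlen i j (v^-1 * w).
Proof.
move=> av aw; have [c ->] := is_cj_unique (cjP a i) av.
have [d ->] := is_cj_unique (cjP a j) aw.
by rewrite invgM -gmulfV !mulgA -[_ * _ * cj a j]mulgA dlen_mul.
Qed.

Lemma dist_triangle a i j : (dist a j <= (dist a i + dist2 a i j).+1)%N.
Proof.
by have := rlen_triangle splitG i j (cj a i) ((cj a i)^-1 * cj a j); rewrite mulVKg.
Qed.

Lemma dist2_triangle a i k j : (dist2 a i j <= (dist2 a i k + dist2 a k j).+1)%N.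
Proof.
have := dlen_triangle splitG i k j ((cj a i)^-1 * cj a k) ((cj a k)^-1 * cj a j).
by rewrite mulgA mulgK.
Qed.

Lemma cj_pconj_neq i j (hij : i != j) g a k w : k != j -> is_cj a k w ->
  is_cj (pconj hij g * a) k w.
Proof. by move=> kj aw x; rewrite autM_E pconj_neq. Qed.

(** The element a(g) fixes the vertex v_i, so this replacement of v_j is a rotation about v_i. *)
Lemma cj_pconj i j (hij : i != j) g a w : is_cj a j w ->
  is_cj (pconj hij g * a) j (a (iota i g) * w).
Proof.
move=> aw x; rewrite autM_E pconj_eq !aut_morph autV_E; have [y ->] := aw x.
by exists y; rewrite invgM !mulgA.
Qed.

Lemma pconj_fix i j (hij : i != j) g a k x : k != j ->
  (pconj hij g * a) (iota k x) = a (iota k x).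
Proof. by move=> kj; rewrite autM_E pconj_neq. Qed.

Lemma dist_pconj_neq i j (hij : i != j) g a k : k != j ->
  dist (pconj hij g * a)%g k = dist a k.
Proof. by move=> kj; rewrite (dist_cj (cj_pconj_neq hij g kj (cjP a k))). Qed.

Lemma dist2_pconj_neq i j (hij : i != j) g a k l : k != j -> l != j ->
  dist2 (pconj hij g * a) k l = dist2 a k l.
Proof.
move=> kj lj; rewrite (dist2_cj (cj_pconj_neq hij g kj (cjP a k))
  (cj_pconj_neq hij g lj (cjP a l))) //.
Qed.

Lemma dist2_pconj_center i j (hij : i != j) g a :
  dist2 (pconj hij g * a) i j = dist2 a i j.
Proof.
rewrite (dist2_cj (cj_pconj_neq hij g hij (cjP a i)) (cj_pconj hij g (cjP a j))).
have [y ->] := cjP a i g; rewrite -!mulgA mulKg (dlen_mull splitG) //.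
Qed.

(** Both vertices v_j and v_k are moved by the same element a(g). *)
Lemma dist2_pconj_both i j k (hij : i != j) (hik : i != k) g a : j != k ->
  dist2 (pconj hik g * (pconj hij g * a)) k j = dist2 a k j.
Proof.
move=> jk; have kj : k != j by rewrite eq_sym.
rewrite (dist2_cj (cj_pconj hik g (cj_pconj_neq hij g kj (cjP a k)))
  (cj_pconj_neq hik g jk (cj_pconj hij g (cjP a j)))).
by rewrite pconj_fix // invgM !mulgA mulgVK.
Qed.

Lemma dist_pconj_swap i j k l (hij : i != j) (hkl : k != l) g h a :
  l != j -> k != j ->
  dist (pconj hkl h * (pconj hij g * a)) l = dist (pconj hkl h * a)%g l.
Proof.
move=> lj kj; rewrite (dist_cj (cj_pconj hkl h (cj_pconj_neq hij g lj (cjP a l)))).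
by rewrite (dist_cj (cj_pconj hkl h (cjP a l))) pconj_fix.
Qed.

Lemma dist_rotate i j (hij : i != j) a : exists g0,
  (dist (pconj hij g0 * a)%g j <= dist a i + dist2 a i j)%N /\
  forall g, g != g0 -> dist (pconj hij g * a)%g j = (dist a i + dist2 a i j).+1.
Proof.
have [y0 [le0 eq0]] := rlen_rotate splitG (cj a i) ((cj a i)^-1 * cj a j) hij.
have dE g y : a (iota i g) = cj a i * iota i y * (cj a i)^-1 ->
    dist (pconj hij g * a)%g j = rlen j (cj a i * iota i y * ((cj a i)^-1 * cj a j)).
  by move=> E; rewrite (dist_cj (cj_pconj hij g (cjP a j))) E !mulgA.
have [g0 E0] := is_cj_onto (cjP a i) y0; exists g0; split; first by rewrite (dE _ _ E0).
move=> g gg0; have [y Ey] := cjP a i g; rewrite (dE _ _ Ey) eq0 //.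
apply: contra_neq gg0 => yy0; apply: (is_free_product_inj splitG).
by apply: (bij_inj (aut_bij a)); rewrite Ey E0 yy0.
Qed.

Lemma dist_nested i j k a : i != j -> k != j -> i != k ->
  dist a j = (dist a i + dist2 a i j).+1 -> dist a j = (dist a k + dist2 a k j).+1 ->
  dist a k = (dist a i + dist2 a i k).+1 \/ dist a i = (dist a k + dist2 a k i).+1.
Proof.
move=> ij kj ik E1 E2; have := rlen_nested ij kj ik E1 E2.
by case=> le; [left|right]; apply/eqP; rewrite eqn_leq dist_triangle.
Qed.

Definition height a := (\sum_i dist a i)%N.

(** Only the summand j changes; the additive form avoids truncated subtraction. *)
Lemma height_pconj i j (hij : i != j) g a :
  (height (pconj hij g * a)%g + dist a j = height a + dist (pconj hij g * a)%g j)%N.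
Proof.
rewrite /height (bigD1 j) //= [in RHS](bigD1 j) //=.
rewrite (eq_bigr (dist a)); first by lia.
by move=> k kj; rewrite dist_pconj_neq.
Qed.

Lemma dist0_factor a : (forall k, dist a k = 0%N) ->
  exists phi, a = factor_aut splitG phi.
Proof.
move=> d0; apply/factor_autP => i.
have c1 : is_cj a i 1.
  have [c [_ Ec]] := rlenP splitG i (cj a i).
  have E1 : cj a i * iota i c = 1.
    by apply: (@len0_eq _ _ _ _ splitG); rewrite Ec; apply: d0.
  move=> x; have [y ->] := cjP a i x; exists (c^-1 * y * c).
  have -> : cj a i = iota i c^-1.
    by apply: (@mulIg _ (iota i c)); rewrite E1 -iotaM mulVg gmulf1.
  by rewrite invg1 mulg1 mul1g -gmulfV invgK -!iotaM.
apply/seteqP; split=> [_ [_ [x _ <-] <-]|_ [x _ <-]].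
  by have [y ->] := c1 x; exists y => //; rewrite invg1 mulg1 mul1g.
have [y Ey] := is_cj_onto c1 x; exists (iota i y); first by exists y.
by rewrite Ey invg1 mulg1 mul1g.
Qed.

(** Shortest representatives of the vertices satisfy the hypotheses of [irreducible_frame]: a prefix
    relation would contradict the assumed inequality by [prefix_dlen], and surjectivity of a makes
    the conjugated factors generate G. Hence all vertices are at distance 0. *)
Lemma irreducible_factor a :
  (forall i j, i != j -> (dist a j <= dist a i + dist2 a i j)%N) ->
  exists phi, a = factor_aut splitG phi.
Proof.
move=> irr; apply: dist0_factor => k.
pose c i := sval (cid (rlenP splitG i (cj a i))).
have cP i : minr splitG i (cj a i * iota i (c i)) /\
  len splitG (cj a i * iota i (c i)) = rlen i (cj a i) by rewrite /c; case: cid.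
pose u i := cj a i * iota i (c i).
have um i : minr splitG i (u i) by case: (cP i).
have uirr i j (x : G_ i) z : i != j ->
    gnf splitG (u j) <> gnf splitG (u i) ++ Tagged G_ x :: z.
  move=> ij E; have := prefix_dlen (@um j) (@um i) E.
  by rewrite -/(dist a i) -/(dist a j) -/(dist2 a i j) ltnNge irr.
have surj (g : G) : exists w : fp_word G_, fp_eval (conj_in iota u) w = g.
  have aV x : a (a^-1 x) = x by exact: aut_inv_funK.
  rewrite -(aV g); elim/(group_ind splitG): (a^-1 g) => [|i x h [w Ew]].
    by exists [::]; rewrite eval_nil gmulf1.
  have [y Ey] := cjP a i x; exists (Tagged G_ ((c i)^-1 * y * c i) :: w).
  rewrite eval_cons Ew aut_morph Ey; congr (_ * _).
  by rewrite /= /conj_left /u !gmulfM gmulfV invgM !mulgA !mulgK.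
have := irreducible_frame um uirr ntG surj k; rewrite /dist.
by case: (cP k) => _ <- E; rewrite -/(u k) E len1.
Qed.

Lemma ex_reduction a : (forall phi, a <> factor_aut splitG phi) ->
  exists i j (hij : i != j) g, (dist (pconj hij g * a)%g j < dist a j)%N.
Proof.
move=> nf; apply: contrapT => nred.
have [phi /nf //] : exists phi, a = factor_aut splitG phi.
apply: irreducible_factor => i j hij; have [g0 [le _]] := dist_rotate hij a.
rewrite leqNgt; apply/negP => lt; apply: nred; exists i, j, hij, g0.
exact: leq_ltn_trans le lt.
Qed.

(** Only the exceptional rotation [g0] can shorten. It is not 1, since 1 changes nothing; so a
    itself is one of the other rotations, for which the distance is known exactly. *)
Lemma reduction_unique i j (hij : i != j) g a :
  (dist (pconj hij g * a)%g j < dist a j)%N ->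
  dist a j = (dist a i + dist2 a i j).+1 /\
  forall h, (dist (pconj hij h * a)%g j < dist a j)%N -> h = g.
Proof.
move=> lt; have [g0 [le eq0]] := dist_rotate hij a; have tri := dist_triangle a i j.
have uniq0 h : (dist (pconj hij h * a)%g j < dist a j)%N -> h = g0.
  by move=> lth; apply/eqP/negPn/negP => /eq0 E; move: lth; rewrite E; lia.
rewrite (uniq0 g lt); split; last exact: uniq0.
have [g01|g01] := eqVneq 1 g0; last by rewrite -(eq0 1 g01) gmulf1 mul1g.
by have := lt; rewrite (uniq0 g lt) -g01 gmulf1 mul1g ltnn.
Qed.

Lemma ex_reduction_through i j (hij : i != j) a :
  dist a j = (dist a i + dist2 a i j).+1 ->
  exists g, (dist (pconj hij g * a)%g j < dist a j)%N.
Proof.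
by move=> E; have [g0 [le _]] := dist_rotate hij a; exists g0; rewrite E ltnS.
Qed.

End VertexDistances.

(** * Evaluating automorphisms in the presented group *)

Section Evaluation.
Variables (n : nat) (G : groupType) (G_ : 'I_n -> groupType).
Variable iota : forall i, {hom G_ i -> G}.
Hypothesis splitG : is_free_product iota.
Hypothesis ntG : forall i, ~ trivial_group (G_ i).
Hypothesis cjE : forall a i, exists w, is_cj iota a i w.
Implicit Types (i j k l : 'I_n) (a b : Aut G).
Local Notation pconj := (pconj splitG).
Local Notation factor_aut := (factor_aut splitG).
Local Notation dist := (dist splitG cjE).
Local Notation dist2 := (dist2 splitG cjE).
Local Notation height := (height splitG cjE).

Variables (Gam : groupType) (e : forall i j, i != j -> {hom G_ i -> Gam}).
Variable ePhi : {hom Phi G_ -> Gam}.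
Hypothesis e_commute1 : forall i j k (hij : i != j) (hik : i != k) g h,
  j != k -> commute (e hij g) (e hik h).
Hypothesis e_commute2 : forall i j k l (hij : i != j) (hkl : k != l) g h,
  uniq [:: i; j; k; l] -> commute (e hij g) (e hkl h).
Hypothesis e_commute3 : forall i j k (hjk : j != k) (hij : i != j) (hik : i != k) g h,
  commute (e hjk g) (e hij h * e hik h).
Hypothesis e_Phi : forall i j (hij : i != j) g phi,
  (ePhi phi)^-1 * e hij g * ePhi phi = e hij (phi i g).

Record move := Move { mv_i : 'I_n; mv_j : 'I_n; mv_ij : mv_i != mv_j; mv_g : G_ mv_i }.

Definition apply_move m a := pconj (mv_ij m) (mv_g m) * a.
Definition move_value m := e (mv_ij m) (mv_g m).
Definition reduces m a := (dist (apply_move m a) (mv_j m) < dist a (mv_j m))%N.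

Definition factor_value a : Gam :=
  if pselect (exists phi, a = factor_aut phi) is left ex then ePhi (sval (cid ex)) else 1.

(** Follows arbitrarily chosen reducing moves until none is left. [N] is fuel, sufficient once it
    bounds the height; independence of the choices is the confluence proved below. *)
Fixpoint value_rec N a : Gam :=
  if N is N'.+1 then
    if pselect (exists m, reduces m a) is left ex then
      let m := sval (cid ex) in (move_value m)^-1 * value_rec N' (apply_move m a)
    else factor_value a
  else factor_value a.

Definition value a := value_rec (height a) a.

Lemma factor_valueE phi : factor_value (factor_aut phi) = ePhi phi.
Proof.
rewrite /factor_value; case: pselect => [ex|[]]; last by exists phi.
by case: cid => psi /= /factor_aut_inj ->.
Qed.

Lemma height_reduces m a : reduces m a -> (height (apply_move m a) < height a)%N.
Proof.
move=> r; have := height_pconj splitG ntG cjE (mv_ij m) (mv_g m) a.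
by move: r; rewrite /reduces /apply_move; lia.
Qed.

Lemma height_le m a N : (height a <= N.+1)%N -> reduces m a ->
  (height (apply_move m a) <= N)%N.
Proof. by move=> aN /height_reduces lt; rewrite -ltnS; apply: leq_trans lt aN. Qed.

Lemma value_fuel N N' a : (height a <= N)%N -> (height a <= N')%N ->
  value_rec N a = value_rec N' a.
Proof.
have r0 b m : (height b <= 0)%N -> ~ reduces m b.
  by rewrite leqn0 => /eqP b0 /height_reduces; rewrite b0.
elim: N N' a => [|N IH] [|N'] a aN aN' //=.
- by case: pselect => // ex; have [m /(r0 _ _ aN)] := ex.
- by case: pselect => // ex; have [m /(r0 _ _ aN')] := ex.
case: pselect => // ex; case: cid => m /= ma; congr (_ * _).
by apply: IH; apply: height_le.
Qed.

Lemma value_reduce a m0 : reduces m0 a ->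
  exists m, reduces m a /\ value (apply_move m a) = move_value m * value a.
Proof.
move=> r0; rewrite [value a](@value_fuel _ (height a).+1) //=.
case: pselect => [ex|[]]; last by exists m0.
case: cid => m /= ma; exists m; split=> //; rewrite mulVKg.
by apply: value_fuel => //; apply/ltnW/height_reduces.
Qed.

Lemma value_irreducible a : (forall m, ~ reduces m a) -> value a = factor_value a.
Proof.
move=> nr; rewrite /value; case: (height a) => //= N.
by case: pselect => // ex; have [m /nr] := ex.
Qed.

Definition consistent m a := value (apply_move m a) = move_value m * value a.

Lemma apply_move1 i j (hij : i != j) a : apply_move (Move hij 1) a = a.
Proof. by rewrite /apply_move /= gmulf1 mul1g. Qed.

Lemma apply_moveM i j (hij : i != j) g h a :
  apply_move (Move hij g) (apply_move (Move hij h) a) = apply_move (Move hij (g * h)) a.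
Proof. by rewrite /apply_move /= gmulfM mulgA. Qed.

(** Extends consistency from reducing moves to all moves. The rotations of v_j about v_i have one
    exceptional member [g0], reached from every other one by a reducing move; both ends of the given
    move are compared with it. *)
Lemma consistent_below N :
  (forall a m, (height a < N)%N -> reduces m a -> consistent m a) ->
  forall a m, (height a < N)%N -> (height (apply_move m a) < N)%N -> consistent m a.
Proof.
move=> cN a [i j hij g] aN maN.
have [g0 [le eq0]] := dist_rotate splitG ntG cjE hij a.
have red h : h != g0 -> reduces (Move hij (g0 * h^-1)) (apply_move (Move hij h) a).
  move=> hg0; rewrite /reduces apply_moveM mulgVK /=.
  by rewrite [X in (_ < X)%N](eq0 h hg0) ltnS.
have cons h : (height (apply_move (Move hij h) a) < N)%N ->
    value (apply_move (Move hij g0) a) =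
      e hij (g0 * h^-1) * value (apply_move (Move hij h) a).
  move=> hN; have [->|hg0] := eqVneq h g0; first by rewrite mulgV gmulf1 mul1g.
  by have := cN _ _ hN (red h hg0); rewrite /consistent apply_moveM mulgVK.
have := cons 1; rewrite apply_move1 => /(_ aN); rewrite (cons g maN) invg1 mulg1.
rewrite /consistent /move_value /= => E.
apply: (@mulgI _ (e hij (g0 * g^-1))); rewrite E gmulfM gmulfV !mulgA mulgVK //.
Qed.

Lemma commute_square i j k l (hij : i != j) (hkl : k != l) g h a :
  k != j -> i != l -> j != l ->
  [/\ apply_move (Move hij g) (apply_move (Move hkl h) a) =
      apply_move (Move hkl h) (apply_move (Move hij g) a)
    & commute (e hij g) (e hkl h)].
Proof.
move=> kj il jl; have [ik|ik] := eqVneq i k.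
  case: k / ik hkl h kj => hkl h kj; split; last exact: e_commute1.
  by rewrite /apply_move /= !mulgA (pconj_commute1 splitG hij hkl g h jl).
have uq : uniq [:: i; j; k; l].
  rewrite /= !inE !negb_or hij ik il jl hkl !andbT /=; by rewrite eq_sym.
split; last exact: e_commute2.
by rewrite /apply_move /= !mulgA (pconj_commute2 splitG hij hkl g h uq).
Qed.

Section Confluence.
Variable N : nat.
Hypothesis consN : forall a m, (height a < N)%N -> (height (apply_move m a) < N)%N ->
  consistent m a.

Definition agree a m m' :=
  (move_value m)^-1 * value (apply_move m a) =
  (move_value m')^-1 * value (apply_move m' a).

(** A commuting square whose other three corners lie below the height of a; [consN] applies to the
    two sides away from a. *)
Lemma confluence_commute i j k l (hij : i != j) (hkl : k != l) g h a :
  (height a <= N)%N -> reduces (Move hij g) a -> reduces (Move hkl h) a ->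
  k != j -> i != l -> j != l -> agree a (Move hij g) (Move hkl h).
Proof.
move=> aN r1 r2 kj il jl; have [E C] := commute_square hij hkl g h a kj il jl.
have lj : l != j by rewrite eq_sym.
have H1 := leq_trans (height_reduces r1) aN.
have H2 := leq_trans (height_reduces r2) aN.
have r3 : reduces (Move hkl h) (apply_move (Move hij g) a).
  by rewrite /reduces /apply_move /= dist_pconj_swap // [X in (_ < X)%N]dist_pconj_neq.
have H3 := leq_trans (height_reduces r3) (ltnW H1).
have C1 := consN H1 H3; rewrite -E in H3.
have C2 := consN H2 H3; rewrite /consistent E in C2.
rewrite /agree; apply: (@mulgI _ (move_value (Move hkl h) * move_value (Move hij g))).
rewrite mulgA mulgK -C1 [_ (apply_move _ (apply_move _ _))]C2.
by rewrite -(C : _ * _ = _) !mulgA mulgK.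
Qed.

(* The vertices of i, k and j follow each other on a geodesic. Rotating k and j
   about i, and j about k, commute by relation 3, and the common result [c]
   as well as all intermediate automorphisms have smaller height than [a]. *)
Lemma confluence_chain i k j (hik : i != k) (hkj : k != j) (hij : i != j) g h a :
  (height a <= N)%N -> reduces (Move hik h) a -> reduces (Move hkj g) a ->
  reduces (Move hij h) a /\ agree a (Move hik h) (Move hkj g).
Proof.
move=> aN r1 r2.
have [/= Ek _] := reduction_unique ntG r1.
have [/= Ej _] := reduction_unique ntG r2.
have jk : j != k by rewrite eq_sym.
have r3 : reduces (Move hij h) a.
  (* Rotating v_k and v_j together about v_i keeps their mutual distance. As v_k comes closer to the
     base point, the triangle inequality through v_k brings v_j closer too. *)
  rewrite /reduces /=.
  set a'' := pconj hik h * (pconj hij h * a).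
  have E1 : dist a'' j = dist (pconj hij h * a) j by apply: dist_pconj_neq.
  have E2 : dist2 a'' k j = dist2 a k j by apply: dist2_pconj_both.
  have E3 : dist a'' k = dist (pconj hik h * a) k by apply: dist_pconj_swap.
  have := dist_triangle splitG cjE a'' k j; move: r1.
  rewrite /reduces /apply_move /= in E1 E2 E3 *.
  by rewrite E1 E2 E3 Ej; lia.
split=> //.
pose a1 := pconj hkj g * a; pose a2 := pconj hik h * a.
pose b := pconj hik h * a1; pose c := pconj hij h * b; pose b' := pconj hij h * a2.
have Ec : c = pconj hkj g * b'.
  rewrite /c /b /a1 /b' /a2 !mulgA; congr (_ * a).
  have E1 : pconj hij h * pconj hik h = pconj hik h * pconj hij h.
    exact: pconj_commute1.
  have E3 := pconj_commute3 splitG hkj hik hij g h; rewrite /commute in E3.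
  by rewrite E1 -[RHS]mulgA E1 E3.
have {}r1 : (dist a2 k < dist a k)%N := r1.
have {}r2 : (dist a1 j < dist a j)%N := r2.
have {}r3 : (dist (pconj hij h * a)%g j < dist a j)%N := r3.
have Ha1 := height_pconj splitG ntG cjE hkj g a.
have Hb := height_pconj splitG ntG cjE hik h a1.
have Hc := height_pconj splitG ntG cjE hij h b.
have Ha2 := height_pconj splitG ntG cjE hik h a.
have Hb' := height_pconj splitG ntG cjE hij h a2.
rewrite -/a1 -/a2 -/b -/c -/b' in Ha1 Hb Hc Ha2 Hb'.
have D1 : dist a1 k = dist a k by apply: dist_pconj_neq.
have D2 : dist b k = dist a2 k by apply: dist_pconj_swap.
have D3 : dist b j = dist a1 j by apply: dist_pconj_neq.
have D4 : dist b' j = dist (pconj hij h * a) j by apply: dist_pconj_swap.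
have D5 : dist a2 j = dist a j by apply: dist_pconj_neq.
have D6 : dist c i = dist a i by rewrite /c /b /a1 !dist_pconj_neq.
have D7 : dist2 c i j = dist2 a1 i j.
  by rewrite [LHS]dist2_pconj_center // [LHS]dist2_pconj_neq.
have D8 : dist2 a1 i k = dist2 a i k by apply: dist2_pconj_neq.
have D9 : dist2 a1 k j = dist2 a k j by apply: dist2_pconj_center.
(* Since v_i stays in place, [T1] and [T2] bound the distance of v_j in [c] by its distance in [a].
   The strict gain at k then puts [c] below [a] in height. *)
have T1 := dist_triangle splitG cjE c i j.
have T2 := dist2_triangle splitG cjE a1 i k j.
have C1 : value b = e hik h * value a1.
  by apply: (@consN a1 (Move hik h)); [lia | rewrite -[apply_move _ _]/b; lia].
have C2 : value c = e hij h * value b.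
  by apply: (@consN b (Move hij h)); [lia | rewrite -[apply_move _ _]/c; lia].
have C3 : value b' = e hij h * value a2.
  by apply: (@consN a2 (Move hij h)); [lia | rewrite -[apply_move _ _]/b'; lia].
have C4 : value c = e hkj g * value b'.
  rewrite [in LHS]Ec; apply: (@consN b' (Move hkj g)); first by lia.
  by rewrite /apply_move /= -Ec; lia.
have E1 : e hij h * e hik h = e hik h * e hij h := e_commute1 hij hik h h jk.
have C := e_commute3 hkj hik hij g h; rewrite /commute -E1 in C.
rewrite C1 C4 C3 !mulgA in C2.
rewrite /agree /move_value /= /apply_move /= -/a1 -/a2.
apply: (@mulgI _ (e hkj g * (e hij h * e hik h))); rewrite {2}C !mulgA !mulgK.
exact: C2.
Qed.

(** Two moves with the same target have equal centres, hence are equal, or have nested centres. With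
    different targets, either the centre of one is the target of the other, which is a chain, or the
    moves commute. *)
Lemma confluence a m m' : (height a <= N)%N -> reduces m a -> reduces m' a ->
  agree a m m'.
Proof.
case: m m' => [i j hij g] [k l hkl h] aN r1 r2.
have [/= Ej uj] := reduction_unique ntG r1; have [/= El ul] := reduction_unique ntG r2.
have [jl|jl] := eqVneq j l.
  case: l / jl hkl r2 El ul => hkj r2 Ej' uj'.
  have [ik|ik] := eqVneq i k.
    case: k / ik h hkj r2 Ej' uj' => h hij' r2 _ _.
    by rewrite /agree (bool_irrelevance hij' hij) -(uj h) // (bool_irrelevance hij hij').
  have ki : k != i by rewrite eq_sym.
  case: (dist_nested hij hkj ik Ej Ej') => E.
    (* The auxiliary rotation of v_k about v_i links the two given moves: it forms a chain with the
       one about v_k, and commutes with the one about v_i, which is forced to rotate by the same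
       [h0]. *)
    have [h0 r0] := ex_reduction_through ntG ik E.
    have [r3 ag] := confluence_chain hij aN (r0 : reduces (Move ik h0) a) r2.
    rewrite -(uj _ r3) /agree -[RHS]ag.
    by apply: confluence_commute => //; rewrite eq_sym.
  have [g0 r0] := ex_reduction_through ntG ki E.
  have [r3 ag] := confluence_chain hkj aN (r0 : reduces (Move ki g0) a) r1.
  rewrite -(uj' _ r3) /agree -[LHS]ag.
  by apply: confluence_commute => //; rewrite eq_sym.
have [kj|kj] := eqVneq k j.
  case: j / kj hij jl Ej uj r1 => hik jl Ej uj r1.
  have [il|il] := eqVneq i l; last by have [_] := confluence_chain il aN r1 r2.
  (* Two vertices cannot each lie strictly beyond the other. *)
  by case: l / il hkl jl El ul r2 => hki _ El; move: Ej; rewrite El; lia.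
have [il|il] := eqVneq i l; last exact: confluence_commute.
case: l / il hkl jl El ul r2 => hki ji El ul r2.
by have [_ /esym] := confluence_chain kj aN r2 r1.
Qed.

End Confluence.

Lemma consistent_reduces N a m : (height a < N)%N -> reduces m a -> consistent m a.
Proof.
elim: N a m => // N IH a m aN r.
have consN := consistent_below (fun a m => @IH a m).
have [m' [r' E]] := value_reduce r.
have := confluence consN aN r r'; rewrite /agree E mulKg /consistent => <-.
by rewrite mulVKg.
Qed.

Lemma value_pconj i j (hij : i != j) g a : value (pconj hij g * a) = e hij g * value a.
Proof.
pose N := (maxn (height a) (height (pconj hij g * a)%g)).+1.
apply: (@consistent_below N _ a (Move hij g)).
- by move=> b m; apply: consistent_reduces.
- by rewrite /N ltnS leq_maxl.
- by rewrite /N ltnS leq_maxr.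
Qed.

Lemma value_factor phi : value (factor_aut phi) = ePhi phi.
Proof.
rewrite value_irreducible ?factor_valueE // => m; rewrite /reduces.
suff -> : dist (factor_aut phi) (mv_j m) = 0%N by [].
rewrite (@dist_cj _ _ _ _ splitG ntG cjE _ _ 1); last first.
  by move=> x; exists (phi _ x); rewrite factor_autE mul1g invg1 mulg1.
by apply/eqP; rewrite -leqn0 -(len1 splitG) rlen_le1.
Qed.

Lemma factor_or_reduces a : (exists phi, a = factor_aut phi) \/ exists m, reduces m a.
Proof.
have [ex|nex] := pselect (exists phi, a = factor_aut phi); [by left | right].
have [phi E|i [j [hij [g lt]]]] := @ex_reduction _ _ _ _ splitG ntG cjE a.
  by apply: nex; exists phi.
by exists (Move hij g).
Qed.

Lemma aut_ind (P : Aut G -> Prop) : (forall phi, P (factor_aut phi)) ->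
  (forall i j (hij : i != j) g a, P a -> P (pconj hij g * a)) -> forall a, P a.
Proof.
move=> Pf Pp a; have [N] := ubnP (height a); elim: N a => // N IH a aN.
have [[phi ->] //|[[i j hij g] r]] := factor_or_reduces a.
rewrite -[a](mulKg (pconj hij g)) -gmulfV; apply: Pp; apply: IH.
exact: leq_trans (height_reduces r) aN.
Qed.

(** Relation 5 carries the factor automorphism past a rotation, whose element is first replaced by
    its preimage under [phi i]. *)
Lemma value_factorM phi a : value (factor_aut phi * a) = ePhi phi * value a.
Proof.
elim/aut_ind: a => [psi|i j hij g a IH].
  by rewrite -gmulfM !value_factor gmulfM.
pose g' := (phi i)^-1 g; have gE : phi i g' = g by exact: aut_inv_funK.
rewrite mulgA -{1}gE -factor_pconj -mulgA !value_pconj IH -[in RHS]gE -e_Phi.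
by rewrite !mulgA mulgV mul1g.
Qed.

Lemma valueM : {morph value : a b / a * b}.
Proof.
move=> a b; elim/aut_ind: a => [phi|i j hij g a IH].
  by rewrite value_factorM value_factor.
by rewrite -mulgA !value_pconj IH mulgA.
Qed.

Fact value_morph : monoid_morphism value.
Proof.
by split; [rewrite -(gmulf1 (s := factor_aut)) value_factor gmulf1 | exact: valueM].
Qed.
HB.instance Definition _ := isUMagmaMorphism.Build (Aut G) Gam value value_morph.

Hypothesis e_Ad : forall i (v : seq {j : 'I_n | i != j}) g,
  uniq v -> (forall t, t \in v) -> \prod_(t <- v) e (valP t) g = ePhi (Ad g).

Lemma value_pconj1 i j (hij : i != j) g : value (pconj hij g) = e hij g.
Proof. by rewrite -[pconj _ _]mulg1 value_pconj (gmulf1 (s := value)) mulg1. Qed.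

(** It suffices to treat x in a factor. There [inn_factor] expresses the inner automorphism through
    a product of rotations and [Ad g], whose values agree by relation 4. *)
Lemma value_inn x : value (inn x) = 1.
Proof.
elim/(group_ind splitG): x => [|i g x IH]; first by rewrite !gmulf1.
rewrite (gmulfM (s := @inn G)) valueM IH mulg1.
pose v := enum {: {j : 'I_n | i != j}}.
have uv : uniq v by exact: enum_uniq.
have vT t : t \in v by rewrite mem_enum.
have := congr1 value (inn_factor splitG g uv vT).
rewrite valueM value_factor -(e_Ad g uv vT) => E.
apply: (@mulgI _ (\prod_(t <- v) e (valP t) g)); rewrite mulg1 -{2}E; congr (_ * _).
rewrite gmulf_prod; by apply: eq_bigr => t _; apply: esym; exact: value_pconj1.
Qed.

Lemma value_Inn a : Inn G a -> value a = 1.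
Proof. by case=> x ->; apply: value_inn. Qed.

Definition out_value : {hom Out G -> Gam} := quotg_lift value_Inn.

Lemma out_value_pconj i j (hij : i != j) g : out_value (f_out splitG hij g) = e hij g.
Proof. exact: etrans (quotg_liftE value_Inn _) (value_pconj1 _ _).
Qed.

Lemma out_value_factor phi : out_value (Phi_out splitG phi) = ePhi phi.
Proof. exact: etrans (quotg_liftE value_Inn _) (value_factor _). Qed.

End Evaluation.

Lemma inj_surj_bijective (A B : Type) (f : A -> B) :
  injective f -> (forall y, exists x, f x = y) -> bijective f.
Proof.
move=> fI fS; exists (fun y => sval (cid (fS y))) => [x|y]; last by case: cid.
by apply: fI; case: cid.
Qed.

Section HomOf.
Variables (G H : groupType) (f : G -> H) (fM : {morph f : x y / x * y}).

Definition hom_of of {morph f : x y / x * y} := f.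

Fact hom_of_morph : monoid_morphism (hom_of fM).
Proof. by split=> //; apply: (@mulgI _ (f 1)); rewrite -fM !mulg1. Qed.
HB.instance Definition _ := isUMagmaMorphism.Build G H (hom_of fM) hom_of_morph.
End HomOf.

Section Kernel.
Variables (G H : groupType) (f : {hom G -> H}).
Definition ker_mem (x : G) : Prop := f x = 1.
Fact ker1 : ker_mem 1. Proof. exact: gmulf1. Qed.
Fact kerM x y : ker_mem x -> ker_mem y -> ker_mem (x * y).
Proof. by rewrite /ker_mem gmulfM => -> ->; rewrite mulg1. Qed.
Fact kerV x : ker_mem x -> ker_mem x^-1.
Proof. by rewrite /ker_mem gmulfV => ->; rewrite invg1. Qed.
Fact kerJ x y : ker_mem x -> ker_mem (x ^ y).
Proof. by rewrite /ker_mem gmulfJ => ->; rewrite conj1g. Qed.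
Definition kernel := NormalSubgroup ker1 kerM kerV kerJ.
End Kernel.

(** * Injectivity and assembly of the presentation *)

Section FactorConjugates.
Variables (I : choiceType) (K : I -> groupType) (G : groupType).
Variable iota : forall i, {hom K i -> G}.
Hypothesis splitG : is_free_product iota.

Definition retraction_on i k : {hom K k -> K i} :=
  if pselect (k = i) is left e then ecast j {hom K k -> K j} e idfun
  else @one_fun (K k) (K i).

Lemma retraction_on_same i (a : K i) : retraction_on i i a = a.
Proof. by rewrite /retraction_on; case: pselect => // e; rewrite eq_axiomK. Qed.

Lemma retraction_on_neq i k (b : K k) : i != k -> retraction_on i k b = 1.
Proof. rewrite /retraction_on; by case: pselect => [e /eqP[]|]. Qed.

(** The retraction of G onto [K i] that kills every other factor sends the right-hand side to 1. *)
Lemma factor_disjoint i k w (a : K i) (b : K k) :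
  i != k -> iota i a = w * iota k b * w^-1 -> a = 1.
Proof.
move=> ik; pose r : {hom G -> K i} := fp_ext splitG (retraction_on i).
have rE j (c : K j) : r (iota j c) = retraction_on i j c := fp_extE splitG _ _.
have rJ : r (w * iota k b * w^-1) = r w * r (iota k b) * (r w)^-1.
  by rewrite !gmulfM gmulfV.
by move=> /(congr1 r); rewrite rJ !rE retraction_on_same retraction_on_neq // mulg1 mulgV.
Qed.

(** Malnormality puts w in both factors, which meet trivially. *)
Lemma centralizing_factors i k w (a : K i) (b : K k) (a' : K i) (b' : K k) :
  i != k -> a != 1 -> b != 1 ->
  w^-1 * iota i a * w = iota i a' -> w^-1 * iota k b * w = iota k b' -> w = 1.
Proof.
move=> ik a1 b1 Ea Eb; have [c wc] := factor_malnormal splitG a1 Ea.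
have [d wd] := factor_malnormal splitG b1 Eb.
rewrite wc (factor_disjoint (w := 1) (a := c) (b := d) ik) ?gmulf1 //.
by rewrite -wc wd mul1g invg1 mulg1.
Qed.

End FactorConjugates.

Section PureSymmetric.
Variables (n : nat) (G : groupType) (G_ : 'I_n -> groupType).
Variable iota : forall i, {hom G_ i -> G}.
Hypothesis splitG : is_free_product iota.
Hypothesis ntG : forall i, ~ trivial_group (G_ i).
Hypothesis indecG : forall i, freely_indecomposable (G_ i).
Hypothesis nzG : forall i, ~ infinite_cyclic (G_ i).
Hypothesis nisoG : forall i j : 'I_n, i != j -> ~ isomorphic (G_ i) (G_ j).

(** Kurosh embeds a(G_i) in a conjugate of some G_k, and the preimage of G_k in a conjugate of some
    G_l. Comparing the two gives l = i, then an isomorphism of G_i with G_k, so k = i. *)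
Lemma aut_factor_conjugate (a : Aut G) i : exists w, is_cj iota a i w.
Proof.
have into (b : Aut G) k :
    exists l x, forall h, exists y, b (iota k h) = x * iota l y * x^-1.
  pose jb : {hom G_ k -> G} := b \o iota k.
  have jbI : injective jb.
    by apply: inj_comp; [exact: bij_inj (aut_bij b) | exact: is_free_product_inj].
  exact: (indecomposable_in_conjugate splitG jbI (@indecG k) (@nzG k) (@ntG k)).
have [k [x ax]] := into a i; have [l [z bz]] := into a^-1 k.
have aV t : a (a^-1 t) = t by exact: aut_inv_funK.
have Va t : a^-1 (a t) = t by exact: aut_funK.
pose w := a^-1 x * z.
have wE y t : a^-1 (iota k y) = z * iota l t * z^-1 ->
    a^-1 (x * iota k y * x^-1) = w * iota l t * w^-1.
  by move=> E; rewrite !aut_morph autV_E E /w invgM !mulgA.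
have [h0 h01] := ex_nt ntG i.
have iw h : exists t, iota i h = w * iota l t * w^-1.
  have [y Ey] := ax h; have [t Et] := bz y; exists t.
  by rewrite -(wE _ _ Et) -Ey Va.
have [il|il] := eqVneq i l; last first.
  by have [t Et] := iw h0; case/eqP: h01; apply: (factor_disjoint splitG il Et).
case: l / il z bz w wE iw => z bz w wE iw.
have [c wc] : exists c, w = iota i c.
  have [t Et] := iw h0.
  apply: (@factor_malnormal _ _ _ _ splitG i w h0 t) => //.
  by rewrite Et !mulgA mulVg mul1g mulgVK.
have fP h : exists y, a (iota i h) = x * iota k y * x^-1 := ax h.
pose f h := sval (cid (fP h)).
have fE h : a (iota i h) = x * iota k (f h) * x^-1 by rewrite /f; case: cid.
have kE y y' : x * iota k y * x^-1 = x * iota k y' * x^-1 -> y = y'.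
  by move/mulIg/mulgI/(is_free_product_inj splitG).
have fM : {morph f : s t / s * t}.
  by move=> s t; apply: kE; rewrite -fE !(iotaM iota) aut_morph !fE !mulgA mulgVK.
have [ik|ik] := eqVneq i k; last first.
  case: (nisoG ik); exists (hom_of fM); apply: inj_surj_bijective => [s t st|y].
    apply: (is_free_product_inj splitG); apply: (bij_inj (aut_bij a)).
    by rewrite !fE; congr (_ * iota k _ * _).
  (* The total conjugator [w] is the image of [c], so this preimage stays inside G_i. *)
  have [t Et] := bz y; exists (c * t * c^-1); apply: kE; rewrite -fE.
  by rewrite !(iotaM iota) gmulfV -wc -(wE _ _ Et) aV.
by exists x; case: k / ik {wE bz f fE kE fM fP} x ax.
Qed.

End PureSymmetric.

Section OutInjectivity.
Variables (n : nat) (G : groupType) (G_ : 'I_n -> groupType).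
Variable iota : forall i, {hom G_ i -> G}.
Hypothesis splitG : is_free_product iota.
Hypothesis ntG : forall i, ~ trivial_group (G_ i).
Hypothesis n_gt2 : (2 < n)%N.

Lemma ex_third (i j : 'I_n) : exists k, k != i /\ k != j.
Proof.
apply: contrapT => /forallNP nk.
have := @uniq_leq_size _ (enum 'I_n) [:: i; j] (enum_uniq _).
rewrite size_enum_ord => le; have := n_gt2; rewrite ltnNge => /negP; apply.
apply: le => k _.
rewrite !inE; apply: contrapT => /negP; rewrite negb_or => /andP[ki kj].
by apply: (nk k).
Qed.

Lemma out_class_eq1 (a : Aut G) : out_class G a = 1 -> exists w, a = inn w.
Proof. by move=> /esym /(qclassP (Inn G) 1 a); rewrite invg1 mul1g. Qed.

(** An inner representative fixes G_i and a third factor pointwise, so its conjugator is 1. Then g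
    centralises G_j, and malnormality puts it in G_j as well as in G_i. *)
Lemma f_out_inj (i j : 'I_n) (hij : i != j) : injective (f_out splitG hij).
Proof.
apply: gmulf_inj => g /out_class_eq1 [w E].
have [k [ki kj]] := ex_third i j; have [x x1] := ex_nt ntG i; have [y y1] := ex_nt ntG k.
have fixE l (z : G_ l) : l != j -> w^-1 * iota l z * w = iota l z.
  by move=> lj; rewrite -innE -E pconj_neq.
have w1 : w = 1.
  apply: (centralizing_factors splitG _ x1 y1 (fixE _ _ hij) (fixE _ _ kj)).
  by rewrite eq_sym.
have [z z1] := ex_nt ntG j.
have Ez : (iota i g)^-1^-1 * iota j z * (iota i g)^-1 = iota j z.
  by rewrite invgK -(pconj_eq splitG hij) E w1 innE invg1 mul1g mulg1.
have [c Ec] := factor_malnormal splitG z1 Ez.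
have : g^-1 = 1.
  apply: (factor_disjoint splitG (w := 1) (b := c) hij).
  by rewrite gmulfV Ec mul1g invg1 mulg1.
by move/eqP; rewrite invg_eq1 => /eqP.
Qed.

(** An inner automorphism preserving two different factors is trivial. *)
Lemma Phi_out_inj : injective (Phi_out splitG).
Proof.
apply: gmulf_inj => phi /out_class_eq1 [w E].
have [i [k ik]] : exists i k : 'I_n, i != k.
  have n_gt0 : (0 < n)%N by apply: leq_trans n_gt2.
  have [k [ki _]] := ex_third (Ordinal n_gt0) (Ordinal n_gt0).
  by exists k, (Ordinal n_gt0).
have [x x1] := ex_nt ntG i; have [y y1] := ex_nt ntG k.
have fE l (z : G_ l) : w^-1 * iota l z * w = iota l (phi l z).
  by rewrite -innE -E factor_autE.
have w1 := centralizing_factors splitG ik x1 y1 (fE _ _) (fE _ _).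
apply: (@factor_aut_inj _ _ _ _ splitG); rewrite gmulf1 E w1.
exact: gmulf1.
Qed.

End OutInjectivity.

(** * The presented group and its isomorphism with Out(G) *)

Section Presentation.
Variables (n : nat) (G : groupType) (G_ : 'I_n -> groupType).
Variable iota : forall i, {hom G_ i -> G}.
Hypothesis splitG : is_free_product iota.

Local Notation kappa := (gen_map splitG).
Local Notation L := (free_prod (gen_group splitG)).

Definition gen_lift : {hom L -> Out G} := fp_lift kappa.

Lemma gen_lift_f i j (hij : i != j) g :
  gen_lift (gen_f splitG hij g) = out_class G (pconj splitG hij g).
Proof.
rewrite /gen_lift /= /gen_f fp_lift_in /=.
by rewrite -[RHS]/(f_out splitG hij g); congr (f_out splitG _ g); exact: bool_irrelevance.
Qed.

Lemma gen_lift_Phi phi :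
  gen_lift (gen_Phi splitG phi) = out_class G (factor_aut splitG phi).
Proof. by rewrite /gen_lift /= /gen_Phi fp_lift_in. Qed.

Lemma out_class_commute (a b : Aut G) : commute a b ->
  [~ out_class G a, out_class G b] = 1.
Proof. by move=> /commgP/eqP ab; rewrite -gmulfR ab gmulf1. Qed.

Lemma gen_lift_relator r : out_relators splitG r -> gen_lift r = 1.
Proof.
case=> {r} [i j k hij hik g h jk|i j k l hij hkl g h uq|i j k hjk hij hik g h
  |i v g uv vT|i j hij g phi].
- by rewrite gmulfR !gen_lift_f; apply/out_class_commute/pconj_commute1.
- by rewrite gmulfR !gen_lift_f; apply/out_class_commute/pconj_commute2.
- rewrite gmulfR gmulfM !gen_lift_f -(gmulfM (s := out_class G)).
  by apply/out_class_commute/pconj_commute3.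
(* Relation 4 holds only modulo inner automorphisms: the discrepancy is [inn (iota i g)], trivial in
   [Out G]. *)
- rewrite gmulfF gmulf_prod gen_lift_Phi -(inn_factor splitG g uv vT).
  have -> : \prod_(t <- v) gen_lift (gen_f splitG (valP t) g)
          = out_class G (\prod_(t <- v) pconj splitG (valP t) g).
    by rewrite gmulf_prod; apply: eq_bigr => t _; rewrite gen_lift_f.
  rewrite gmulfM [out_class G (inn _)](_ : _ = 1) ?mulg1 ?mulgV //.
  rewrite -(gmulf1 (s := out_class G)); apply: esym; apply/(qclassP (Inn G)).
  by rewrite invg1 mul1g; exists (iota i g).
- have -> : gen_lift ((gen_Phi splitG phi)^-1 * gen_f splitG hij g * gen_Phi splitG phi
      / gen_f splitG hij (phi i g)) =
    out_class G ((factor_aut splitG phi)^-1 * pconj splitG hij g * factor_aut splitG phi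
      / pconj splitG hij (phi i g)).
    have gM x y : gen_lift (x * y) = gen_lift x * gen_lift y := gmulfM x y.
    have oM x y : out_class G (x * y) = out_class G x * out_class G y := gmulfM x y.
    by rewrite !gM !oM !gmulfV !gen_lift_f gen_lift_Phi.
  by rewrite -(mulgA _ (pconj _ _ _)) factor_pconj mulKg mulgV gmulf1.
Qed.

Lemma normal_closure_sub (A : groupType) (R : set A) (N : normal_subgroup A) x :
  (forall r, R r -> N r) -> normal_closure R x -> N x.
Proof. by move=> RN; apply. Qed.

Lemma gen_lift_relation x : normal_closure (out_relators splitG) x -> gen_lift x = 1.
Proof.
by apply: (@normal_closure_sub _ _ (kernel gen_lift)) => r; apply: gen_lift_relator.
Qed.

Local Notation Gam := (quotg (normal_closure (out_relators splitG))).
Definition rel_class : {hom L -> Gam} := @qclass _ (normal_closure (out_relators splitG)).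

Lemma rel_class1 r : out_relators splitG r -> rel_class r = 1.
Proof.
move=> Rr; apply: esym; apply/(qclassP (normal_closure (out_relators splitG))).
by rewrite invg1 mul1g => N; apply.
Qed.

Definition e_index i j (hij : i != j) : offdiag n := exist _ (i, j) hij.

Definition in_gen s : {hom gen_group splitG s -> L} := @fp_in _ (gen_group splitG) s.

Definition e_hom (i j : 'I_n) (hij : i != j) : {hom G_ i -> Gam} :=
  rel_class \o ((in_gen (Some (e_index hij))
              : {hom hom_image (f_out splitG (valP (e_index hij))) -> L})
    \o to_image (f_out splitG (valP (e_index hij)))).

Lemma e_homE i j (hij : i != j) g : e_hom hij g = rel_class (gen_f splitG hij g).
Proof. by []. Qed.

Definition ePhi_hom : {hom Phi G_ -> Gam} :=
  rel_class \o (in_gen None : {hom Phi G_ -> L}).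

Lemma ePhi_homE phi : ePhi_hom phi = rel_class (gen_Phi splitG phi).
Proof. by []. Qed.

Lemma e_hom_commute1 i j k (hij : i != j) (hik : i != k) g h :
  j != k -> commute (e_hom hij g) (e_hom hik h).
Proof.
move=> jk; apply/commgP/eqP; rewrite !e_homE -gmulfR.
exact/rel_class1/out_rel1.
Qed.

Lemma e_hom_commute2 i j k l (hij : i != j) (hkl : k != l) g h :
  uniq [:: i; j; k; l] -> commute (e_hom hij g) (e_hom hkl h).
Proof.
move=> uq; apply/commgP/eqP; rewrite !e_homE -gmulfR.
exact/rel_class1/out_rel2.
Qed.

Lemma e_hom_commute3 i j k (hjk : j != k) (hij : i != j) (hik : i != k) g h :
  commute (e_hom hjk g) (e_hom hij h * e_hom hik h).
Proof.
apply/commgP/eqP; rewrite !e_homE -(gmulfM (s := rel_class)) -gmulfR.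
exact/rel_class1/out_rel3.
Qed.

Lemma e_hom_Phi i j (hij : i != j) g phi :
  (ePhi_hom phi)^-1 * e_hom hij g * ePhi_hom phi = e_hom hij (phi i g).
Proof.
have := rel_class1 (out_rel5 splitG hij g phi); rewrite !e_homE !ePhi_homE.
have rM x y : rel_class (x * y) = rel_class x * rel_class y := gmulfM x y.
by rewrite !rM !gmulfV => /divg1_eq.
Qed.

Lemma e_hom_Ad i (v : seq {j : 'I_n | i != j}) g :
  uniq v -> (forall t, t \in v) -> \prod_(t <- v) e_hom (valP t) g = ePhi_hom (Ad g).
Proof.
move=> uv vT; have := rel_class1 (out_rel4 splitG g uv vT); rewrite ePhi_homE.
rewrite gmulfF gmulf_prod => /divg1_eq.
exact.
Qed.

Hypothesis ntG : forall i, ~ trivial_group (G_ i).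
Hypothesis cjE : forall a i, exists w, is_cj iota a i w.

Definition out_to_rel : {hom Out G -> Gam} :=
  out_value splitG ntG cjE e_hom_commute1 e_hom_commute2 e_hom_commute3
    e_hom_Phi e_hom_Ad.

Lemma out_to_rel_f i j (hij : i != j) g : out_to_rel (f_out splitG hij g) = e_hom hij g.
Proof. exact: out_value_pconj. Qed.

Lemma out_to_rel_Phi phi : out_to_rel (Phi_out splitG phi) = ePhi_hom phi.
Proof. exact: out_value_factor. Qed.

Lemma out_to_rel_gen s y : out_to_rel (kappa s y) = rel_class (in_gen s y).
Proof.
case: s y => [[[i j] hij] y|phi]; last exact: out_to_rel_Phi.
have /asboolP[g Eg] : in_image (f_out splitG (valP (e_index hij))) (image_val y).
  by case: y.
have -> : y = to_image (f_out splitG (valP (e_index hij))) g by apply: val_inj.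
rewrite -[RHS]/(e_hom hij g) -out_to_rel_f; congr (out_to_rel (f_out splitG _ g)).
exact: bool_irrelevance.
Qed.

Lemma out_to_relK x : out_to_rel (gen_lift x) = rel_class x.
Proof.
apply: (@fp_hom_eq _ (gen_group splitG) _ (out_to_rel \o gen_lift) rel_class) => s y.
exact: etrans (congr1 out_to_rel (fp_lift_in _ _)) (out_to_rel_gen y).
Qed.

Definition rel_lift : {hom Gam -> Out G} := quotg_lift gen_lift_relation.

Lemma rel_liftE x : rel_lift (rel_class x) = gen_lift x.
Proof. exact: (quotg_liftE gen_lift_relation). Qed.

(** Induction over [aut_ind]; this is where the generation of Out(G) enters. *)
Lemma rel_liftK a : rel_lift (out_to_rel (out_class G a)) = out_class G a.
Proof.
elim/(aut_ind (splitG := splitG) ntG cjE): a => [phi|i j hij g a IH].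
  rewrite -[out_class G _]/(Phi_out splitG phi) out_to_rel_Phi ePhi_homE.
  by rewrite rel_liftE gen_lift_Phi.
have oM x y : out_class G (x * y) = out_class G x * out_class G y := gmulfM x y.
have sM x y : out_to_rel (x * y) = out_to_rel x * out_to_rel y := gmulfM x y.
have rM x y : rel_lift (x * y) = rel_lift x * rel_lift y := gmulfM x y.
rewrite oM sM rM IH; congr (_ * _).
by rewrite -[out_class G _]/(f_out splitG hij g) out_to_rel_f e_homE rel_liftE gen_lift_f.
Qed.

Lemma presented_by_out_relators : presented_by kappa (out_relators splitG).
Proof.
exists gen_lift_relation; exists out_to_rel => [q|o].
  have := out_to_relK (qrepr q); rewrite -rel_liftE /rel_class /= qreprK; exact.
have := rel_liftK (qrepr o); rewrite /out_class /= qreprK; exact.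
Qed.

End Presentation.

(** The first two clauses justify the identifications of G_i with its image in Out(G), and of Phi
    with the classes of factor automorphisms. *)
Theorem corollary4p1p2 (n : nat) (n_ge5 : (5 <= n)%N)
    (G : groupType) (G_ : 'I_n -> groupType)
    (iota : forall i : 'I_n, {hom G_ i -> G})
    (splitG : is_free_product iota)
    (G_nontrivial : forall i : 'I_n, ~ trivial_group (G_ i))
    (G_indec : forall i : 'I_n, freely_indecomposable (G_ i))
    (G_not_Z : forall i : 'I_n, ~ infinite_cyclic (G_ i))
    (G_noniso : forall i j : 'I_n, i != j -> ~ isomorphic (G_ i) (G_ j)) :
  [/\ forall (i j : 'I_n) (hij : i != j), bijective (to_image (f_out splitG hij)),
      injective (Phi_out splitG)
    & presented_by (gen_map splitG) (out_relators splitG)].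
Proof.
have n_gt2 : (2 < n)%N by apply: leq_trans n_ge5.
split=> [i j hij||].
- apply: inj_surj_bijective => [g h E|[y yi]].
    apply: (f_out_inj (splitG := splitG) G_nontrivial n_gt2 (hij := hij)).
    by have := congr1 val E.
  by have /asboolP[g Eg] := yi; exists g; apply: val_inj.
- exact: Phi_out_inj.
- apply: presented_by_out_relators => //.
  exact: aut_factor_conjugate G_nontrivial G_indec G_not_Z G_noniso.
Qed.
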